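(* Let $S=\{g_1,\dots,g_s\}\subset\mathbb{R}[X_0]$ be a finite set of homogeneous polynomials of even degree and $K_S^h$ its corresponding homogeneous semialgebraic set. Let $K_S^h=K\,\dot\cup\,K_0$ be a disjoint union of closed sets (closed in $\mathbb{R}^{n+1}\setminus\{0\}$) such that the interior of $K_S^h$ is contained in $K$. Let $g\in\mathbb{R}[X_0]$ be a homogeneous polynomial of even degree $d>0$ which is positive at every point of $K$ and equals zero at every point of $K_0$. Suppose that there exists a polynomial $g_-\in M_S^h$ such that, for all $X_0\in\mathbb{R}^{n+1}\setminus\{0\}$, $g(X_0)\le 0$ implies $g_-(X_0)<0$, and such that $K\subseteq\{X_0\mid g_-(X_0)>0\}$. Then for each homogeneous polynomial $f\in\mathbb{R}[X_0]$ which is positive at every point of $K$ and whose degree is a multiple of $d$, there exists $N\in\mathbb{N}$ with $g^N f\in M_S^h$.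
   Context: $\mathbb{R}[X_0]:=\mathbb{R}[x_0,x_1,\dots,x_n]$. For a finite set $S=\{g_1,\dots,g_s\}\subset\mathbb{R}[X_0]$ of homogeneous polynomials, $K_S^h:=\{x\in\mathbb{R}^{n+1}\setminus\{0\}\mid g_i(x)\ge 0,\ i=1,\dots,s\}$. $\sum\mathbb{R}[X_0]^2_h$ denotes the set of finite sums of squares of homogeneous polynomials of the same degree. The homogeneous quadratic module $M_S^h$ is the set of all sums $\sum_{i=0}^{s}\sigma_i g_i$ with $g_0:=1$ and $\sigma_i\in\sum\mathbb{R}[X_0]^2_h$, such that all terms $\sigma_i g_i$ have the same degree (zero terms are allowed and are regarded as homogeneous of any degree). *)

(* Defs.v *)
From mathcomp Require Import all_boot all_order all_algebra.
From mathcomp Require Import all_classical all_reals all_analysis.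
(* The notations of [mpoly] clash with those of [all_analysis]; everything else
   (canonical structures, coercions) is imported. *)
From mathcomp Require mpoly.
Import -(notations) mpoly.

Set Implicit Arguments.
Unset Strict Implicit.
Unset Printing Implicit Defensive.

Import Order.TTheory GRing.Theory Num.Theory.
Import numFieldNormedType.Exports.

Local Open Scope classical_set_scope.
Local Open Scope ring_scope.

(* R[x_0, ..., x_n] *)
Notation polyX0 R n := (mpoly n.+1 R).

Section HomogeneousQuadraticModule.
Variables (R : realType) (n : nat).

Definition peval (p : polyX0 R n) (x : 'rV[R]_n.+1) : R :=
  meval (fun i => x ord0 i) p.

(* This is [p \is d.-homog]; 0 is homogeneous of every degree. *)
Definition homogeneous (d : nat) (p : polyX0 R n) : Prop :=
  p \is ishomog1 d mdeg.

Definition punctured : set 'rV[R]_n.+1 := [set x | x != 0].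

(* Relatively closed subsets of R^{n+1} \ {0}. *)
Definition closed_punctured (A : set 'rV[R]_n.+1) : Prop :=
  A `<=` punctured /\ closed (A : set (subspace punctured)).

Definition KSh (s : nat) (S : 'I_s -> polyX0 R n) : set 'rV[R]_n.+1 :=
  [set x | x != 0 /\ forall i, 0 <= peval (S i) x].

Definition sos_h (p : polyX0 R n) : Prop :=
  exists (k : nat) (qs : seq (polyX0 R n)),
    (forall q, q \in qs -> homogeneous k q) /\ p = \sum_(q <- qs) q ^+ 2.

(* The family g_0 := 1, g_1, ..., g_s. *)
Definition gfam (s : nat) (S : 'I_s -> polyX0 R n) (i : 'I_s.+1) :
    polyX0 R n :=
  if unlift ord0 i is Some j then S j else 1.

(* A zero term is homogeneous of every degree D. *)
Definition MSh (s : nat) (S : 'I_s -> polyX0 R n) (p : polyX0 R n) : Prop :=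
  exists (D : nat) (sigma : 'I_s.+1 -> polyX0 R n),
    [/\ forall i, sos_h (sigma i),
        forall i, homogeneous D (sigma i * gfam S i)
      & p = \sum_(i < s.+1) sigma i * gfam S i].

End HomogeneousQuadraticModule.

(* Main.v *)
Require Import Defs.
From mathcomp Require Import all_boot all_order all_algebra.
From mathcomp Require Import all_classical all_reals all_analysis.
From mathcomp Require mpoly.
Import -(notations) mpoly.
From mathcomp Require Import ring lra zify.
Import Order.TTheory GRing.Theory Num.Theory.
Import numFieldNormedType.Exports.

Set Implicit Arguments.
Unset Strict Implicit.
Unset Printing Implicit Defensive.

Local Open Scope classical_set_scope.
Local Open Scope ring_scope.

(** Write [h] for the given element of the quadratic module that is negative
    wherever [g <= 0].  On a point of [K0] the form [g] vanishes, so [h] is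
    negative there, although elements of the module are nonnegative on
    [KSh S]; hence [K0] is empty and [f] is positive on the whole of [KSh S].
    The theorem is then a strict Positivstellensatz with denominators that are
    powers of [g] ([localized_positivstellensatz]).

    It is first proved with powers of [|x|^2] as denominators.  A form that is
    positive on the unit sphere becomes a sum of squares of forms after
    multiplication by a power of [|x|^2] ([form_pos_on_sphere_sos]): on the
    sphere [1 - x_i] and [1 + x_i] are sums of squares, so every polynomial
    positive on the cube is one too ([pos_on_cube]), and
    averaging over [x] and [- x] makes the squares homogeneous.  For a form [f]
    positive on [{G_i >= 0}] one subtracts from [f] suitable multiples of the
    [G_i] by squares so that the difference is positive everywhere on the sphere
    ([strict_positivstellensatz]).

    To replace [|x|^2] by [g], this result is applied to [1] and [h] alone,
    which generate a quadratic module [T] closed under products.  It contains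
    [|x|^(2N) * (c * g^2 - |x|^(2d))], and from [Q * (P - Q)] in [T] follows
    [P^2 - Q^2 = 2 * Q * (P - Q) + (P - Q)^2] in [T].  This yields
    [L - N] in [T], where [L] is a constant times a power of [g] and [N] is a
    power of [|x|^2] of the same degree ([norm_below_power]).  The quotient
    [N / L] is then bounded above by [1] modulo [T], and bounded below by a
    positive constant because every form is dominated by a power of [|x|^2]
    ([form_bounded_by_nsq]).  A polynomial in [N / L] that approximates a power
    of [L / N] on this interval therefore turns a denominator [N^r] into a power
    of [L] ([denominator_exchange]).

    All memberships are established in quadratic modules whose multipliers are
    sums of squares of forms of arbitrary, possibly different, degrees.  Degrees
    only matter in the last step, where the homogeneous component of the right
    degree is extracted ([hqm_component]). *)

(** * Bernstein means *)

Section BernsteinMean.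
Variable A : comPzRingType.
Implicit Types (u : A) (phi : nat -> A).

(** The mean of [phi] under the binomial distribution with [N] trials and success
    probability [u], where [u] is only an element of the ring.  Recursion on the
    first trial makes binomial coefficients unnecessary. *)
Fixpoint bernstein_mean u (N : nat) phi : A :=
  if N is N'.+1 then
    u * bernstein_mean u N' (phi \o S) + (1 - u) * bernstein_mean u N' phi
  else phi 0%N.

(** The variance of the binomial distribution is [N * u * (1 - u)].  The shift [c]
    is what makes the induction on [N] go through. *)
Lemma bernstein_mean_quadratic u N a b c :
  bernstein_mean u N (fun k => a + b * (k%:R - N%:R * u + c) ^+ 2)
  = a + b * (c ^+ 2 + N%:R * u * (1 - u)).
Proof.
elim: N c => [|N IH] c /=; first by ring.
have E1 : (fun k => a + b * (k%:R - N.+1%:R * u + c) ^+ 2) \o S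
        = fun k => a + b * (k%:R - N%:R * u + (c + 1 - u)) ^+ 2.
  by apply/funext => k /=; rewrite -[k.+1]addn1 -[N.+1]addn1 !natrD; ring.
have E2 : (fun k => a + b * (k%:R - N.+1%:R * u + c) ^+ 2)
        = fun k => a + b * (k%:R - N%:R * u + (c - u)) ^+ 2.
  by apply/funext => k; rewrite -[N.+1]addn1 natrD; ring.
by rewrite E1 E2 !IH -[N.+1]addn1 natrD; ring.
Qed.

Lemma bernstein_mean_closed (T : A -> Prop) u N phi :
  (forall a b, T a -> T b -> T (a + b)) ->
  (forall a b, T a -> T b -> T (a * b)) ->
  T u -> T (1 - u) -> (forall k, (k <= N)%N -> T (phi k)) ->
  T (bernstein_mean u N phi).
Proof.
move=> TD TM Tu Tu1; elim: N phi => [|N IH] phi Tphi /=; first exact: Tphi.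
by apply: (TD); apply: (TM) => //; apply: IH => k kN; apply: Tphi; rewrite /= ?ltnS // ltnW.
Qed.

End BernsteinMean.

(** * Evaluation of polynomials *)

Section Evaluation.
Variables (R : realType) (n : nat).
Local Notation P := (polyX0 R n).
Local Notation cst := (@mpolyC n.+1 R).
Local Notation X_ i := (@mpolyX n.+1 R (@mnm1 n.+1 i)).
Implicit Types (p q : P) (x : 'rV[R]_n.+1).

Lemma mpoly_alg_ind (Q : P -> Prop) :
  (forall c, Q (cst c)) -> (forall i, Q (X_ i)) ->
  (forall p q, Q p -> Q q -> Q (p + q)) ->
  (forall p q, Q p -> Q q -> Q (p * q)) -> forall p, Q p.
Proof.
move=> QC QX QD QM p; elim/mpolyind: p => [|c m p _ _ Qp].
  by rewrite -(mpolyC0 n.+1 R).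
apply: (QD) => //; rewrite -mul_mpolyC; apply: (QM); first exact: QC.
rewrite mpolyXE_id; apply: big_ind => [||i _]; last first.
- elim: (m i) => [|k IH]; first by rewrite expr0 -(mpolyC1 n.+1 R).
  by rewrite exprS; apply: (QM).
- exact: QM.
- by rewrite -(mpolyC1 n.+1 R).
Qed.

Lemma pevalD p q x : peval (p + q) x = peval p x + peval q x.
Proof. exact: rmorphD. Qed.
Lemma pevalN p x : peval (- p) x = - peval p x.
Proof. exact: rmorphN. Qed.
Lemma pevalB p q x : peval (p - q) x = peval p x - peval q x.
Proof. exact: rmorphB. Qed.
Lemma pevalM p q x : peval (p * q) x = peval p x * peval q x.
Proof. exact: rmorphM. Qed.
Lemma pevalXn p k x : peval (p ^+ k) x = peval p x ^+ k.
Proof. exact: rmorphXn. Qed.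
Lemma pevalC c x : peval (cst c) x = c.
Proof. exact: mevalC. Qed.
Lemma pevalX i x : peval (X_ i) x = x ord0 i.
Proof. exact: mevalXU. Qed.
Lemma peval1 x : peval 1 x = 1.
Proof. exact: rmorph1. Qed.
Lemma peval0 x : peval 0 x = 0.
Proof. exact: rmorph0. Qed.
Lemma peval_sum (I : Type) (r : seq I) (Q : pred I) (F : I -> P) x :
  peval (\sum_(i <- r | Q i) F i) x = \sum_(i <- r | Q i) peval (F i) x.
Proof. exact: rmorph_sum. Qed.

Lemma half_double : cst (1/2) * 2 = 1.
Proof. by rewrite -(rmorph_nat cst) -rmorphM -(rmorph1 cst); congr cst; field. Qed.

Definition pevalE := (peval_sum, pevalD, pevalN, pevalM, pevalXn, pevalC, pevalX,
  peval1, peval0).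

Lemma continuous_peval p : continuous (peval p).
Proof.
elim/mpoly_alg_ind: p => [c|i|p q cp cq|p q cp cq] x.
- rewrite (_ : peval _ = fun=> c); first exact: (@cst_continuous _ _ c x).
  by apply/funext => y; rewrite pevalC.
- rewrite (_ : peval _ = fun y : 'rV[R]_n.+1 => y ord0 i).
    exact: (@coord_continuous _ _ _ ord0 i x).
  by apply/funext => y; rewrite pevalX.
- rewrite (_ : peval _ = peval p \+ peval q).
    exact: (@continuousD _ _ _ _ _ x (cp x) (cq x)).
  by apply/funext => y; rewrite pevalD.
- rewrite (_ : peval _ = peval p \* peval q).
    exact: (@continuousM _ _ _ _ x (cp x) (cq x)).
  by apply/funext => y; rewrite pevalM.
Qed.

End Evaluation.

(** * Continuous functions on compact sets *)

Section CompactSets.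
Variables (R : realType) (n : nat).
Implicit Types (A : set 'rV[R]_n.+1).

Lemma compact_lower_bound A (phi : 'rV[R]_n.+1 -> R) :
  compact A -> continuous phi -> exists c : R, forall x, A x -> c <= phi x.
Proof.
move=> cA cphi; have [A0|/set0P/negP/negPn/eqP ->] := pselect (A !=set0); last first.
  by exists 0 => x [].
have [|c _ cmin] := EVT_min_rV A0 cA (f := phi).
  exact: continuous_subspaceT.
by exists (phi c) => x Ax; apply: cmin; rewrite inE.
Qed.

Lemma compact_pos_lower_bound A (phi : 'rV[R]_n.+1 -> R) :
  compact A -> continuous phi -> (forall x, A x -> 0 < phi x) ->
  exists2 e : R, 0 < e & forall x, A x -> e <= phi x.
Proof.
move=> cA cphi phi0.
have [A0|/set0P/negP/negPn/eqP ->] := pselect (A !=set0); last first.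
  by exists 1 => // x [].
have [|c cA' cmin] := EVT_min_rV A0 cA (f := phi).
  exact: continuous_subspaceT.
exists (phi c) => [|x Ax]; first by apply: phi0; rewrite inE in cA'.
by apply: cmin; rewrite inE.
Qed.

(** If [psi] is positive wherever [phi] fails to be, then the maximum of [phi] and
    [psi] has a positive minimum [m] on the compact set: where [phi] is below
    [m], [psi] is at least [m] and a large multiple of it outweighs the lower
    bound of [phi]. *)
Lemma compact_penalty A (phi psi : 'rV[R]_n.+1 -> R) :
  compact A -> continuous phi -> continuous psi ->
  (forall x, A x -> 0 <= psi x) -> (forall x, A x -> phi x <= 0 -> 0 < psi x) ->
  exists C e : R, [/\ 0 < C, 0 < e & forall x, A x -> e <= phi x + C * psi x].
Proof.
move=> cA cphi cpsi psi0 phipsi.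
have [|x Ax|m m0 mle] := compact_pos_lower_bound
    (phi := fun x => Num.max (phi x) (psi x)) cA.
- by move=> x; apply: continuous_max; [exact: cphi | exact: cpsi].
- rewrite lt_max; have [//|p0 /=] := ltP 0 (phi x).
  exact: phipsi.
have [c cle] := compact_lower_bound cA cphi.
pose C := (`|c| + m) / m.
have C0 : 0 < C by rewrite divr_gt0 // ltr_wpDl.
exists C, m; split=> // x Ax.
have := mle x Ax; rewrite le_max => /orP[mphi|mpsi].
  by rewrite (le_trans mphi) // lerDl mulr_ge0 ?psi0 // ltW.
have : C * m <= C * psi x by rewrite ler_pM2l.
rewrite {1}/C mulfVK ?gt_eqF //.
have := cle x Ax; have := ler_norm (- c); rewrite normrN; lra.
Qed.

End CompactSets.

(** * Archimedean preorderings and positivity on a cube *)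

Section ArchimedeanPreordering.
Variables (R : realType) (n : nat).
Local Notation P := (polyX0 R n).
Local Notation cst := (@mpolyC n.+1 R).
Local Notation X_ i := (@mpolyX n.+1 R (@mnm1 n.+1 i)).
Implicit Types (p q u : P) (z : 'rV[R]_n.+1).

Definition cube : set 'rV[R]_n.+1 := [set z | forall i, z ord0 i \in `[-1, 1]].

Lemma compact_cube : compact cube.
Proof.
by apply: (@rV_compact R _ (fun=> `[(-1 : R), 1]%classic)) => _; exact: segment_compact.
Qed.

Variable T : P -> Prop.

(** [p] is bounded by [e] in absolute value, with respect to the order that [T]
    defines on polynomials. *)
Definition pm_bound (e p : P) := T (e - p) /\ T (e + p).

Hypothesis TD : forall p q, T p -> T q -> T (p + q).
Hypothesis TM : forall p q, T p -> T q -> T (p * q).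
Hypothesis TC : forall c, 0 <= c -> T (cst c).
Hypothesis Tsq : forall p, T (p ^+ 2).
Hypothesis TX : forall i, pm_bound 1 (X_ i).

(** [e m - u p] is half of [(e - u) (m + p) + (e + u) (m - p)]. *)
Lemma pm_boundM e m u p : pm_bound e u -> pm_bound m p -> pm_bound (e * m) (u * p).
Proof.
move=> [eu1 eu2] [mp1 mp2].
have h0 : (0 : R) <= 1/2 by lra.
split.
- have -> : e * m - u * p
      = cst (1/2) * ((e - u) * (m + p) + (e + u) * (m - p)).
    have h := half_double R n.
    rewrite -[LHS]mul1r -h; ring.
  by apply: (TM); [exact: TC | apply: (TD); exact: TM].
- have -> : e * m + u * p
      = cst (1/2) * ((e + u) * (m + p) + (e - u) * (m - p)).
    have h := half_double R n.
    rewrite -[LHS]mul1r -h; ring.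
  by apply: (TM); [exact: TC | apply: (TD); exact: TM].
Qed.

Lemma pm_boundD e f u p : pm_bound e u -> pm_bound f p -> pm_bound (e + f) (u + p).
Proof.
move=> [eu1 eu2] [fp1 fp2]; split.
  have -> : e + f - (u + p) = (e - u) + (f - p) by ring.
  exact: TD.
have -> : e + f + (u + p) = (e + u) + (f + p) by ring.
exact: TD.
Qed.

Lemma pm_bound_le e f u : T (f - e) -> pm_bound e u -> pm_bound f u.
Proof.
move=> fe [eu1 eu2]; split.
  have -> : f - u = (f - e) + (e - u) by ring.
  exact: TD.
have -> : f + u = (f - e) + (e + u) by ring.
exact: TD.
Qed.

Lemma pm_boundC c m : `|c| <= m -> pm_bound (cst m) (cst c).
Proof.
rewrite ler_norml => /andP[h1 h2]; split; rewrite -?rmorphB -?rmorphD; apply: TC; lra.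
Qed.

(** The preordering is archimedean, because the variables generate the ring and
    are bounded. *)
Lemma bounded_on_cube p : exists m : R,
  [/\ 0 <= m, pm_bound (cst m) p & forall z, cube z -> `|peval p z| <= m].
Proof.
elim/mpoly_alg_ind: p => [c|i|p q [a [a0 pa ea]] [b [b0 qb eb]]|p q [a [a0 pa ea]] [b [b0 qb eb]]].
- exists `|c|; split=> //; first exact: pm_boundC.
  by move=> z _; rewrite pevalC.
- exists 1; split; first exact: ler01.
    by rewrite mpolyC1; exact: TX.
  by move=> z cz; rewrite pevalX ler_norml; exact: cz.
- exists (a + b); split; first exact: addr_ge0.
    by rewrite rmorphD; exact: pm_boundD.
  by move=> z cz; rewrite pevalD (le_trans (ler_normD _ _)) // lerD ?ea ?eb.
- exists (a * b); split; first exact: mulr_ge0.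
    by rewrite rmorphM; exact: pm_boundM.
  by move=> z cz; rewrite pevalM normrM ler_pM ?ea ?eb.
Qed.

(** The coordinates below [k] are left out because the variables are eliminated
    one at a time. *)
Definition dist2 (k : nat) z : P := \sum_(i < n.+1 | (k <= i)%N) (X_ i - cst (z ord0 i)) ^+ 2.

Lemma T_sum (I : Type) (r : seq I) (Q : pred I) (F : I -> P) :
  (forall i, Q i -> T (F i)) -> T (\sum_(i <- r | Q i) F i).
Proof.
move=> TF; apply: big_ind => //.
by rewrite -(mpolyC0 n.+1 R); apply: TC.
Qed.

(** A quantitative continuity of [p] at [z], read in the order defined by [T], with
    a constant that does not depend on [z].  For [y = X_i - z_i] it is
    [d + y^2 / (4 d) - y = (2 d - y)^2 / (4 d)]. *)
Lemma uniformly_near p d : 0 < d -> exists2 c : R, 0 <= c &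
  forall z, cube z -> pm_bound (cst d + cst c * dist2 0 z) (p - cst (peval p z)).
Proof.
elim/mpoly_alg_ind: p d => [c|i|p q IHp IHq|p q IHp IHq] d d0.
- exists 0 => // z _; rewrite pevalC subrr mpolyC0 mul0r addr0.
  by split; rewrite ?subr0 ?addr0; apply: TC; exact: ltW.
- exists ((4 * d)^-1); first by rewrite invr_ge0 mulr_ge0 // ltW.
  move=> z _; rewrite pevalX /dist2 (bigD1 i) //=.
  set D := \sum_(j | _) _.
  have TDD : T D by apply: T_sum => j _; exact: Tsq.
  set y := X_ i - cst _.
  have hc : 0 <= (4 * d)^-1 by rewrite invr_ge0 mulr_ge0 // ltW.
  have h2 : cst ((4 * d)^-1) * cst (2 * d) * 2 = 1.
    rewrite -(rmorph1 cst) -(rmorph_nat cst) -!rmorphM; congr cst; field.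
    by rewrite gt_eqF.
  have h3 : cst ((4 * d)^-1) * cst (2 * d) ^+2 = cst d.
    rewrite -rmorphXn -!rmorphM; congr cst; field.
    by rewrite gt_eqF.
  split.
  - have -> : cst d + cst (4 * d)^-1 * (y ^+ 2 + D) - y
      = cst (4 * d)^-1 * ((cst (2 * d) - y) ^+ 2 + D).
      by rewrite -[X in _ - X]mul1r -h2 -h3; ring.
    by apply: (TM); [exact: TC | apply: (TD) => //; exact: Tsq].
  - have -> : cst d + cst (4 * d)^-1 * (y ^+ 2 + D) + y
      = cst (4 * d)^-1 * ((cst (2 * d) + y) ^+ 2 + D).
      by rewrite -[X in _ + X]mul1r -h2 -h3; ring.
    by apply: (TM); [exact: TC | apply: (TD) => //; exact: Tsq].
- have d20 : 0 < d / 2 by rewrite divr_gt0.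
  have [a a0 pa] := IHp _ d20; have [b b0 qb] := IHq _ d20.
  exists (a + b); first exact: addr_ge0.
  move=> z cz; rewrite pevalD.
  have -> : cst d + cst (a + b) * dist2 0 z
     = (cst (d / 2) + cst a * dist2 0 z) + (cst (d / 2) + cst b * dist2 0 z).
    have -> : cst d = cst (d/2) + cst (d/2) by rewrite -rmorphD; congr cst; field.
    by rewrite rmorphD; ring.
  have -> : p + q - cst (peval p z + peval q z)
     = (p - cst (peval p z)) + (q - cst (peval q z)) by rewrite rmorphD; ring.
  by apply: pm_boundD; [exact: pa | exact: qb].
- have [mp [mp0 pm _]] := bounded_on_cube p.
  have [mq [mq0 _ eq]] := bounded_on_cube q.
  pose e := d / (mp + mq + 1).
  have e0 : 0 < e by rewrite divr_gt0 // ltr_wpDl // addr_ge0.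
  have [a a0 pa] := IHp _ e0; have [b b0 qb] := IHq _ e0.
  exists (b * mp + a * mq); first by rewrite addr_ge0 // mulr_ge0.
  move=> z cz; rewrite pevalM.
  set D := dist2 0 z.
  have -> : p * q - cst (peval p z * peval q z)
     = (q - cst (peval q z)) * p + (p - cst (peval p z)) * cst (peval q z).
    by rewrite rmorphM; ring.
  apply: (@pm_bound_le ((cst e + cst b * D) * cst mp + (cst e + cst a * D) * cst mq)).
    have -> : cst d + cst (b * mp + a * mq) * D -
       ((cst e + cst b * D) * cst mp + (cst e + cst a * D) * cst mq)
       = cst (d - e * mp - e * mq) by ring.
    apply: (TC).
    have -> : d - e * mp - e * mq = e.
      by rewrite /e; field; rewrite gt_eqF // ltr_wpDl // addr_ge0.
    exact: ltW.
  apply: pm_boundD; apply: pm_boundM => //; [exact: qb | exact: pa |].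
  by apply: pm_boundC; exact: eq.
Qed.

(** The hypothesis is averaged over the points [s = 2 k / N - 1] with the
    Bernstein weights attached to [(1 + X_i) / 2], which belong to [T].  The
    averages of [(X_i - s)^2] are the variances, of order [1 / N]. *)
Lemma eliminate_variable i p c e : 0 <= c -> 0 < e ->
  (forall s, s \in `[-1, 1] -> T (p + cst c * (X_ i - cst s) ^+ 2)) -> T (p + cst e).
Proof.
move=> c0 e0 Tp; have [T1 T2] := TX i.
have [N cN] : exists N : nat, c < e * N.+1%:R.
  exists (Num.truncn (c / e)); rewrite mulrC -ltr_pdivrMr //.
  by rewrite truncnS_gt.
pose u : P := cst (1/2) * (1 + X_ i).
have hh := half_double R n.
have h0 : (0 : R) <= 1/2 by lra.
have u1 : 1 - u = cst (1/2) * (1 - X_ i) by rewrite -{1}hh /u; ring.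
have Tu : T u by apply: (TM) => //; exact: TC.
have Tu1 : T (1 - u) by rewrite u1; apply: (TM) => //; exact: TC.
have N0 : N.+1%:R != 0 :> R by rewrite pnatr_eq0.
pose b := 4 * c / N.+1%:R ^+ 2.
have Tmean : T (p + cst b * (N.+1%:R * u * (1 - u))).
  have := bernstein_mean_quadratic u N.+1 p (cst b) 0.
  rewrite expr0n add0r => <-; apply: bernstein_mean_closed => // k kN.
  pose s : R := 2 * k%:R / N.+1%:R - 1.
  have -> : cst b * (k%:R - N.+1%:R * u + 0) ^+ 2 = cst c * (X_ i - cst s) ^+ 2.
    have -> : X_ i - cst s = - cst (2 / N.+1%:R) * (k%:R - N.+1%:R * u).
      rewrite /s /u.
      have E : cst (2 / N.+1%:R) * N.+1%:R = 2.
        by rewrite -(rmorph_nat cst N.+1) -rmorphM divfK // rmorph_nat.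
      have E2 : cst (2 * k%:R / N.+1%:R - 1) = cst (2 / N.+1%:R) * k%:R - 1.
        by rewrite rmorphB rmorph1 mulrAC rmorphM rmorph_nat.
      rewrite E2.
      transitivity (1 * (1 + X_ i) - cst (2 / N.+1%:R) * k%:R); first by ring.
      by rewrite -{1}hh -{1}E; ring.
    have -> : cst b = cst c * cst (2 / N.+1%:R) ^+ 2.
      by rewrite -[_ ^+ 2](rmorphXn cst) -rmorphM; congr cst; rewrite /b; field.
    by ring.
  apply: Tp; rewrite in_itv /= /s.
  have : (k%:R : R) <= N.+1%:R by rewrite ler_nat.
  have N1 : 0 < N.+1%:R :> R by rewrite ltr0n.
  move=> kN'; have l1 : k%:R / N.+1%:R <= 1 :> R by rewrite ler_pdivrMr // mul1r.
  have l0 : 0 <= k%:R / N.+1%:R :> R by rewrite divr_ge0.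
  have -> : 2 * k%:R / N.+1%:R = 2 * (k%:R / N.+1%:R) :> R by rewrite mulrA.
  by move: (k%:R / _) l0 l1 => y l0 l1; apply/andP; split; lra.
have -> : p + cst e = (p + cst b * (N.+1%:R * u * (1 - u)))
   + (cst (e - c / N.+1%:R) + cst (c / N.+1%:R) * (X_ i) ^+ 2).
  have -> : cst b = cst (c / N.+1%:R) * cst (4 / N.+1%:R).
    by rewrite -rmorphM; congr cst; rewrite /b; field.
  have -> : cst (c / N.+1%:R) * cst (4 / N.+1%:R) * (N.+1%:R * u * (1 - u))
     = cst (c / N.+1%:R) * ((cst (4 / N.+1%:R) * N.+1%:R) * (u * (1 - u))) by ring.
  have -> : cst (4 / N.+1%:R) * N.+1%:R = 4.
    by rewrite -(rmorph_nat cst N.+1) -rmorphM divfK // rmorph_nat.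
  have -> : 4 * (u * (1 - u)) = 1 - X_ i ^+ 2.
    have -> : 4 * (u * (1 - u)) = (cst (1/2) * 2) * (cst (1/2) * 2) * ((1 + X_ i) * (1 - X_ i)).
      by rewrite u1 /u; ring.
    by rewrite hh; ring.
  by ring.
have N1 : 0 < N.+1%:R :> R by rewrite ltr0n.
apply: (TD) => //; apply: (TD); last apply: (TM) => //; apply: TC.
  by rewrite subr_ge0 ler_pdivrMr // ltW.
by rewrite divr_ge0.
Qed.

(** By [uniformly_near] and compactness, [p] minus a positive constant plus a
    multiple of [dist2 0 z] is in [T] for every [z] in the cube, with the same
    constants; the distance terms are then eliminated variable by variable, at
    an arbitrarily small cost each. *)
Theorem pos_on_cube p : (forall z, cube z -> 0 < peval p z) -> T p.
Proof.
move=> ppos.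
have [e e0 ple] := compact_pos_lower_bound compact_cube (@continuous_peval R n p) ppos.
have e20 : 0 < e / 2 by rewrite divr_gt0.
have [c c0 pc] := uniformly_near p e20.
pose q := p - cst (e / 2).
have base z : cube z -> T (q + cst c * dist2 0 z).
  move=> cz; have [_ h] := pc z cz.
  have -> : q + cst c * dist2 0 z
     = (cst (e / 2) + cst c * dist2 0 z + (p - cst (peval p z))) + cst (peval p z - e).
    have -> : q = p - cst e + cst (e/2).
      have E : cst e = cst (e/2) + cst (e/2) by rewrite -rmorphD; congr cst; field.
      by rewrite E /q; ring.
    ring.
  by apply: (TD) => //; apply: TC; rewrite subr_ge0; exact: ple.
have step k : (k <= n.+1)%N -> forall d, 0 < d -> forall z, cube z ->
    T (q + cst c * dist2 k z + cst d).
  elim: k => [_|k IH kn] d d0 z cz.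
    by apply: (TD); [exact: base | apply: TC; exact: ltW].
  have d20 : 0 < d / 2 by rewrite divr_gt0.
  pose ik := Ordinal kn.
  have -> : q + cst c * dist2 k.+1 z + cst d
      = (q + cst c * dist2 k.+1 z + cst (d / 2)) + cst (d / 2).
    have E : cst d = cst (d / 2) + cst (d / 2) by rewrite -rmorphD; congr cst; field.
    by rewrite E addrA.
  apply: (@eliminate_variable ik _ c) => // s si.
  pose z' : 'rV[R]_n.+1 := \row_i (if i == ik then s else z ord0 i).
  have cz' : cube z' by move=> i; rewrite mxE; case: ifP => _ //; exact: cz.
  have := IH (ltnW kn) _ d20 z' cz'.
  rewrite /dist2 (bigD1 ik) //= mxE eqxx.
  rewrite (eq_bigr (fun i => (X_ i - cst (z ord0 i)) ^+ 2)); last first.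
    by move=> i /andP[_ /negbTE iik]; rewrite mxE iik.
  rewrite (eq_bigl (fun i : 'I_n.+1 => (k < i)%N)); last first.
    by move=> i; rewrite ltn_neqAle andbC eq_sym.
  by move=> h; apply: (eq_ind _ T h); ring.
have z0 : cube 0 by move=> i; rewrite mxE in_itv /=; lra.
have := step n.+1 (leqnn _) _ e20 0 z0.
rewrite /dist2 big_pred0 ?mulr0 ?addr0; first by rewrite /q subrK.
by move=> i; rewrite leqNgt ltn_ord.
Qed.

End ArchimedeanPreordering.

(** * Homogeneous polynomials and the unit sphere *)

Section Homogeneous.
Variables (R : realType) (n : nat).
Local Notation P := (polyX0 R n).
Local Notation cst := (@mpolyC n.+1 R).
Local Notation X_ i := (@mpolyX n.+1 R (@mnm1 n.+1 i)).
Implicit Types (p q : P) (x : 'rV[R]_n.+1).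

Lemma homogD d p q : homogeneous d p -> homogeneous d q -> homogeneous d (p + q).
Proof. exact: rpredD. Qed.

Lemma homogB d p q : homogeneous d p -> homogeneous d q -> homogeneous d (p - q).
Proof. exact: rpredB. Qed.

Lemma homog0 d : homogeneous d (0 : P).
Proof. exact: rpred0. Qed.

Lemma homog_sum d (I : Type) (r : seq I) (Q : pred I) (F : I -> P) :
  (forall i, Q i -> homogeneous d (F i)) -> homogeneous d (\sum_(i <- r | Q i) F i).
Proof. exact: rpred_sum. Qed.

Lemma homogM f d e p q :
  homogeneous d p -> homogeneous e q -> (d + e)%N = f -> homogeneous f (p * q).
Proof. by move=> hp hq <-; exact: dhomogM. Qed.

Lemma homogXn f d k p : homogeneous d p -> (d * k)%N = f -> homogeneous f (p ^+ k).
Proof. by move=> hp <-; exact: dhomogMn. Qed.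

Lemma homogC c : homogeneous 0 (cst c).
Proof. by rewrite -[cst c]mulr1 mul_mpolyC; apply: rpredZ; exact: dhomog1. Qed.

Lemma homogCM d c p : homogeneous d p -> homogeneous d (cst c * p).
Proof. by move=> hp; apply: (homogM (homogC c) hp). Qed.

Lemma homogX i : homogeneous 1 (X_ i).
Proof. by rewrite /homogeneous dhomogX; apply/eqP; exact: mdeg1. Qed.

Lemma pevalZ_homog d p a x : homogeneous d p -> peval p (a *: x) = a ^+ d * peval p x.
Proof.
move=> /dhomogP hp; rewrite /peval !mevalE mulr_sumr !big_seq.
apply: eq_bigr => m mp; rewrite mulrCA; congr (_ * _).
have -> : d = (\sum_(i < n.+1) m i)%N by rewrite -(hp m mp); exact: mdegE.
rewrite expr_sum -big_split /=.
by apply: eq_bigr => i _; rewrite mxE exprMn.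
Qed.

(** The exponent of a monomial under the Kronecker substitution of [t^(b^i)] for
    [x_i]. *)
Definition kronecker (b : nat) (m : multinom n.+1) : nat :=
  (\sum_(i < n.+1) m i * b ^ i)%N.

(** Uniqueness of the digits in base [b]. *)
Lemma kronecker_inj b (m m' : multinom n.+1) :
  (forall i, m i < b)%N -> (forall i, m' i < b)%N ->
  kronecker b m = kronecker b m' -> m = m'.
Proof.
move=> mb mb' e; apply/mnmP => i; move: i mb mb' e; rewrite /kronecker.
move: (fun_of_multinom m) (fun_of_multinom m').
elim: (n.+1) => [|k IH] u v i; first by case: i.
move=> ub vb; rewrite !big_ord_recl /= !expn0 !muln1.
have b0 : (0 < b)%N by apply: leq_ltn_trans (ub ord0).
have E w : (\sum_(j < k) w (lift ord0 j) * b ^ (bump 0 j)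
   = (\sum_(j < k) w (lift ord0 j) * b ^ j) * b)%N.
  by rewrite big_distrl /=; apply: eq_bigr => j _; rewrite /bump add1n expnSr mulnA.
rewrite !E => e.
have e0 : u ord0 = v ord0.
  by have := congr1 (fun t => t %% b)%N e; rewrite !(addnC (_ ord0)) !modnMDl !modn_small.
have [j ->|->//] := unliftP ord0 i.
apply: (IH (u \o lift ord0) (v \o lift ord0) j) => [l|l|] /=; [exact: ub|exact: vb|].
by move: e; rewrite e0 => /eqP; rewrite eqn_add2l eqn_pmul2r // => /eqP.
Qed.

(** Under the Kronecker substitution with a large base, distinct monomials of [p]
    become distinct powers of one variable; a polynomial in one variable with
    infinitely many roots is zero. *)
Lemma peval_inj p : (forall x, peval p x = 0) -> p = 0.
Proof.
move=> p0; apply/eqP; apply/negPn/negP => pN0.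
pose b := msize p.
pose h : {poly R} := \sum_(m <- msupp p) (mcoeff m p)%:P * 'X^(kronecker b m).
have hE t : h.[t] = 0.
  rewrite -(p0 (\row_i t ^+ (b ^ i)%N)) /peval mevalE horner_sum.
  apply: eq_bigr => m _; rewrite hornerCM hornerXn; congr (_ * _).
  rewrite /kronecker expr_sum; apply: eq_bigr => i _.
  by rewrite mxE -exprM mulnC.
have h0 : h = 0.
  apply: (@roots_geq_poly_eq0 _ _ [seq k%:R | k <- iota 0 (size h)]).
  - by apply/allP => t _; rewrite /root hE.
  - rewrite map_inj_uniq ?iota_uniq // => i j /eqP; rewrite eqr_nat; exact/eqP.
  - by rewrite size_map size_iota.
have [m0 m0p] : exists m, m \in msupp p.
  by exists (mlead p); exact: mlead_supp.
have lt_b m i : m \in msupp p -> (m i < b)%N.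
  move=> /msize_mdeg_lt; apply: leq_ltn_trans.
  by rewrite mdegE (bigD1 i) //= leq_addr.
have := congr1 (fun f : {poly R} => f`_(kronecker b m0)) h0.
rewrite coef0 /h coef_sum (bigD1_seq m0) ?msupp_uniq //= big_seq_cond big1.
  rewrite addr0 coefCM coefXn eqxx mulr1 => /eqP.
  by rewrite mcoeff_eq0 m0p.
move=> m /andP[mp mm0]; rewrite coefCM coefXn; case: eqP => [e|_]; last by rewrite mulr0.
case/eqP: mm0; apply: (@kronecker_inj b) => // i; exact: lt_b.
Qed.

(** The squared Euclidean norm [|x|^2]. *)
Definition nsq : P := \sum_(i < n.+1) X_ i ^+ 2.

Lemma homog_nsq : homogeneous 2 nsq.
Proof. by apply: homog_sum => i _; apply: (homogXn (homogX i)). Qed.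

Lemma peval_nsq x : peval nsq x = \sum_(i < n.+1) x ord0 i ^+ 2.
Proof. by rewrite peval_sum; apply: eq_bigr => i _; rewrite !pevalE. Qed.

Lemma nsq_ge0 x : 0 <= peval nsq x.
Proof. by rewrite peval_nsq; apply: sumr_ge0 => i _; exact: sqr_ge0. Qed.

Lemma nsq_gt0 x : x != 0 -> 0 < peval nsq x.
Proof.
move=> x0; rewrite lt_def nsq_ge0 andbT; apply: contra x0.
rewrite peval_nsq psumr_eq0 => [/allP h|i _]; last exact: sqr_ge0.
apply/eqP/rowP => i; rewrite mxE; apply/eqP; rewrite -sqrf_eq0.
by have := h i; rewrite mem_index_enum => /(_ isT).
Qed.

Definition sphere : set 'rV[R]_n.+1 := [set x | peval nsq x = 1].

Lemma sphere_neq0 x : sphere x -> x != 0.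
Proof.
rewrite /sphere /= => sx; apply/eqP => x0; move: sx; rewrite x0 peval_nsq big1.
  by move/eqP; rewrite eq_sym oner_eq0.
by move=> i _; rewrite mxE expr0n.
Qed.

Lemma sphereN x : sphere x -> sphere (- x).
Proof. by rewrite /sphere /= -scaleN1r (pevalZ_homog _ _ homog_nsq) sqrrN expr1n mul1r. Qed.

Lemma compact_sphere : compact sphere.
Proof.
apply: (subclosed_compact _ (@compact_cube R n)) => [|x sx i].
  apply: (@preimage_closed _ R (peval nsq) [set x | x = 1]).
    by move=> x _; exact: continuous_peval.
  exact: closed_eq.
have : x ord0 i ^+ 2 <= 1.
  move: sx; rewrite /sphere /= peval_nsq (bigD1 i) //= => <-.
  by rewrite lerDl; apply: sumr_ge0 => j _; exact: sqr_ge0.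
by rewrite in_itv /= expr2 => ?; apply/andP; split; nra.
Qed.

Lemma polar x : exists (r : R) y, sphere y /\ x = r *: y.
Proof.
have [->|x0] := eqVneq x 0.
  exists 0, (delta_mx ord0 ord0); rewrite scale0r; split=> //.
  rewrite /sphere /= peval_nsq (bigD1 ord0) //= big1 => [|i /negbTE i0].
    by rewrite mxE !eqxx expr1n addr0.
  by rewrite mxE i0 andbF expr0n.
have x1 := nsq_gt0 x0.
have r0 : 0 < Num.sqrt (peval nsq x) by rewrite sqrtr_gt0.
exists (Num.sqrt (peval nsq x)), ((Num.sqrt (peval nsq x))^-1 *: x); split.
- rewrite /sphere /= (pevalZ_homog _ _ homog_nsq) exprVn sqr_sqrtr ?nsq_ge0 //.
  by rewrite mulVf // gt_eqF.
- by rewrite scalerA divff ?scale1r // gt_eqF.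
Qed.

Lemma homog_eq_on_sphere d p q : homogeneous d p -> homogeneous d q ->
  (forall x, sphere x -> peval p x = peval q x) -> p = q.
Proof.
move=> hp hq pq; apply/eqP; rewrite -subr_eq0; apply/eqP/peval_inj => x.
have [r [y [sy ->]]] := polar x.
by rewrite (pevalZ_homog _ _ (homogB hp hq)) pevalB pq // subrr mulr0.
Qed.

End Homogeneous.

(** * Quadratic modules with homogeneous multipliers *)

Section QuadraticModule.
Variables (R : realType) (n : nat).
Local Notation P := (polyX0 R n).
Local Notation cst := (@mpolyC n.+1 R).
Implicit Types (p q s : P) (x : 'rV[R]_n.+1).

(** The quadratic module generated by the family [G] with squares of homogeneous
    polynomials as multipliers.  The degrees of the terms are left unrelated, so
    that closure properties need no degree bookkeeping. *)
Inductive hqm (I : Type) (G : I -> P) : P -> Prop :=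
| hqm0 : hqm G 0
| hqmS i k q p : homogeneous k q -> hqm G p -> hqm G (q ^+ 2 * G i + p).

Definition sos : P -> Prop := hqm (fun _ : unit => 1).

Section Family.
Variables (I : Type) (G : I -> P).

Lemma hqmD p q : hqm G p -> hqm G q -> hqm G (p + q).
Proof.
move=> hp hq; elim: hp => [|i k a b ha _ IH]; first by rewrite add0r.
by rewrite -addrA; apply: (hqmS i ha).
Qed.

Lemma hqm_term i k q : homogeneous k q -> hqm G (q ^+ 2 * G i).
Proof. by move=> hq; rewrite -[_ * _]addr0; apply: (hqmS i hq); exact: hqm0. Qed.

Lemma hqm_gen i : hqm G (G i).
Proof.
rewrite -[G i]mul1r -[1](expr1n _ 2).
by apply: (@hqm_term i 0%N); exact: dhomog1.
Qed.

Lemma hqm_ge0 p x : hqm G p -> (forall i, 0 <= peval (G i) x) -> 0 <= peval p x.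
Proof.
move=> hp Gx; elim: hp => [|i k q r _ _ IH]; first by rewrite peval0.
by rewrite pevalD addr_ge0 // pevalM pevalXn mulr_ge0 // sqr_ge0.
Qed.

Lemma hqm_sqM k q p : homogeneous k q -> hqm G p -> hqm G (q ^+ 2 * p).
Proof.
move=> hq; elim=> [|i l a b ha _ IH]; first by rewrite mulr0; exact: hqm0.
rewrite mulrDr mulrA -exprMn; apply: (hqmS i _ IH).
exact: (homogM hq ha).
Qed.

Lemma hqm_sosM s p : sos s -> hqm G p -> hqm G (s * p).
Proof.
move=> hs hp; elim: hs => [|_ k a b ha _ IH]; first by rewrite mul0r; exact: hqm0.
by rewrite mulr1 mulrDl; apply: hqmD => //; exact: hqm_sqM ha hp.
Qed.

Lemma hqm_sum (J : Type) (r : seq J) (Q : pred J) (F : J -> P) :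
  (forall j, Q j -> hqm G (F j)) -> hqm G (\sum_(j <- r | Q j) F j).
Proof. by move=> hF; apply: big_ind => //; [exact: hqm0 | exact: hqmD]. Qed.

End Family.

Lemma hqm_sub (I J : Type) (G : I -> P) (H : J -> P) p :
  (forall i, hqm H (G i)) -> hqm G p -> hqm H p.
Proof.
move=> GH; elim=> [|i k a b ha _ IH]; first exact: hqm0.
by apply: hqmD => //; apply: (hqm_sqM ha).
Qed.

Lemma hqmM (I : Type) (G : I -> P) p q :
  (forall i j, hqm G (G i * G j)) -> hqm G p -> hqm G q -> hqm G (p * q).
Proof.
move=> GG hp hq; elim: hp => [|i k a b ha _ IH]; first by rewrite mul0r; exact: hqm0.
rewrite mulrDl; apply: hqmD => //; rewrite -mulrA; apply: (hqm_sqM ha).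
elim: hq => [|j l c d hc _ IHd]; first by rewrite mulr0; exact: hqm0.
by rewrite mulrDr mulrCA; apply: hqmD => //; apply: (hqm_sqM hc).
Qed.

Lemma hqm_sos (I : Type) (G : I -> P) i s : G i = 1 -> sos s -> hqm G s.
Proof.
by move=> Gi; apply: hqm_sub => _; rewrite -[1]Gi; exact: hqm_gen.
Qed.

Lemma sosD s t : sos s -> sos t -> sos (s + t). Proof. exact: hqmD. Qed.
Lemma sosM s t : sos s -> sos t -> sos (s * t). Proof. exact: hqm_sosM. Qed.

Lemma sos_sq k q : homogeneous k q -> sos (q ^+ 2).
Proof. by move=> hq; rewrite -[_ ^+ 2]mulr1; exact: (@hqm_term _ _ tt _ _ hq). Qed.

Lemma sosC c : 0 <= c -> sos (cst c).
Proof.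
move=> c0; rewrite -(sqr_sqrtr c0) (rmorphXn cst); apply: sos_sq; exact: homogC.
Qed.

Lemma sos1 : sos 1.
Proof. by rewrite -(mpolyC1 n.+1 R); exact/sosC/ler01. Qed.

Lemma sosXn s k : sos s -> sos (s ^+ k).
Proof. by move=> hs; elim: k => [|k IH]; [exact: sos1 | rewrite exprS; exact: sosM]. Qed.

Lemma sos_nsq : sos (nsq R n).
Proof. by apply: hqm_sum => i _; apply: sos_sq; exact: homogX. Qed.

Lemma hqmC (I : Type) (G : I -> P) c p : 0 <= c -> hqm G p -> hqm G (cst c * p).
Proof. by move=> c0; apply: hqm_sosM; exact: sosC. Qed.

End QuadraticModule.

(** * Forms positive on the sphere *)

Section PositiveForms.
Variables (R : realType) (n : nat).
Local Notation P := (polyX0 R n).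
Local Notation cst := (@mpolyC n.+1 R).
Local Notation X_ i := (@mpolyX n.+1 R (@mnm1 n.+1 i)).
Local Notation nsq := (nsq R n).
Local Notation sphere := (sphere (R := R) (n := n)).
Implicit Types (p q s : P) (x : 'rV[R]_n.+1).

Lemma homog_nsqXn k : homogeneous (2 * k) (nsq ^+ k).
Proof. exact: (homogXn (homog_nsq R n)). Qed.

Lemma peval_nsqXn k x : sphere x -> peval (nsq ^+ k) x = 1.
Proof. by move=> sx; rewrite pevalXn sx expr1n. Qed.

(** On the sphere [|x|^2 = 1], so the even part of a polynomial can be made
    homogeneous of an even degree by inserting powers of [|x|^2], and the odd
    part homogeneous of an odd degree. *)
Definition parity_split p (a b : nat) (E U : P) :=
  [/\ homogeneous (2 * a) E, homogeneous (2 * b).+1 U &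
      forall x, sphere x -> peval p x = peval E x + peval U x].

Lemma parity_splitP p : exists a b E U, parity_split p a b E U.
Proof.
elim/mpoly_alg_ind: p => [c|i|p q [a [b [E [U [hE hO pEO]]]]] [c [d [F [Q [hF hQ qFQ]]]]]
   |p q [a [b [E [U [hE hO pEO]]]]] [c [d [F [Q [hF hQ qFQ]]]]]].
- exists 0%N, 0%N, (cst c), 0; split; [exact: homogC | exact: homog0|].
  by move=> x _; rewrite peval0 addr0.
- exists 0%N, 0%N, 0, (X_ i); split; [exact: homog0 | exact: homogX|].
  by move=> x _; rewrite peval0 add0r.
- exists (a + c)%N, (b + d)%N, (nsq ^+ c * E + nsq ^+ a * F), (nsq ^+ d * U + nsq ^+ b * Q).
  split.
  + apply: homogD; [apply: (homogM (homog_nsqXn c) hE); lia|apply: (homogM (homog_nsqXn a) hF); lia].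
  + apply: homogD; [apply: (homogM (homog_nsqXn d) hO); lia|apply: (homogM (homog_nsqXn b) hQ); lia].
  + move=> x sx; rewrite !(pevalD, pevalM) !peval_nsqXn // pEO // qFQ //; ring.
- exists (a + c + (b + d).+1)%N, (a + d + (b + c))%N,
    (nsq ^+ (b + d).+1 * (E * F) + nsq ^+ (a + c) * (U * Q)),
    (nsq ^+ (b + c) * (E * Q) + nsq ^+ (a + d) * (U * F)).
  split.
  + apply: homogD.
      by apply: (homogM (homog_nsqXn _) (homogM hE hF erefl)); lia.
    by apply: (homogM (homog_nsqXn _) (homogM hO hQ erefl)); lia.
  + apply: homogD.
      by apply: (homogM (homog_nsqXn _) (homogM hE hQ erefl)); lia.
    by apply: (homogM (homog_nsqXn _) (homogM hO hF erefl)); lia.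
  + move=> x sx; rewrite !(pevalD, pevalM) !peval_nsqXn // pEO // qFQ //; ring.
Qed.

(** If [q] is [E + Q] on the sphere, then [q^2] is the sum of the even part
    [E^2 + Q^2] and the odd part [2 E Q]; the even part remains a sum of
    squares. *)
Lemma sum_sq_split (qs : seq P) : exists a b A U,
  sos A /\ parity_split (\sum_(q <- qs) q ^+ 2) a b A U.
Proof.
elim: qs => [|q qs [a [b [A [U [sA [hA hO AO]]]]]]].
  exists 0%N, 0%N, 0, 0; split; first exact: hqm0.
  by split; [exact: homog0 | exact: homog0 | move=> x _; rewrite big_nil !peval0 addr0].
have [c [d [E [Q [hE hQ qEQ]]]]] := parity_splitP q.
pose B := nsq ^+ (2 * d).+1 * E ^+ 2 + nsq ^+ (2 * c) * Q ^+ 2.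
pose V := cst 2 * (E * Q).
have hB : homogeneous (2 * (2 * c + (2 * d).+1)) B.
  apply: homogD.
    by apply: (homogM (homog_nsqXn _) (homogXn hE erefl)); lia.
  by apply: (homogM (homog_nsqXn _) (homogXn hQ erefl)); lia.
have hV : homogeneous (2 * (c + d)).+1 V.
  by apply/homogCM; apply: (homogM hE hQ); lia.
have sB : sos B.
  apply: sosD; apply: sosM; [apply: sosXn; exact: sos_nsq|exact: sos_sq hE|
    apply: sosXn; exact: sos_nsq|exact: sos_sq hQ].
exists (2 * c + (2 * d).+1 + a)%N, (c + d + b)%N,
  (nsq ^+ a * B + nsq ^+ (2 * c + (2 * d).+1) * A),
  (nsq ^+ b * V + nsq ^+ (c + d) * U).
split.
  by apply: sosD; apply: sosM => //; apply: sosXn; exact: sos_nsq.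
split.
- apply: homogD; [apply: (homogM (homog_nsqXn _) hB)|apply: (homogM (homog_nsqXn _) hA)]; lia.
- apply: homogD; [apply: (homogM (homog_nsqXn _) hV)|apply: (homogM (homog_nsqXn _) hO)]; lia.
- move=> x sx; rewrite big_cons pevalD AO // pevalXn qEQ // /B /V.
  by rewrite !(pevalD, pevalM, pevalC) !peval_nsqXn // ?pevalXn; ring.
Qed.

Definition sum_sq_on_sphere p :=
  exists qs : seq P, forall x, sphere x -> peval p x = peval (\sum_(q <- qs) q ^+ 2) x.

Lemma sum_sq_on_sphereM p q :
  sum_sq_on_sphere p -> sum_sq_on_sphere q -> sum_sq_on_sphere (p * q).
Proof.
move=> [ps hp] [qs hq]; exists [seq a * b | a <- ps, b <- qs] => x sx.
rewrite pevalM hp // hq // -pevalM; congr (peval _ x).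
rewrite big_allpairs_dep big_distrl; apply: eq_bigr => a _.
by rewrite big_distrr; apply: eq_bigr => b _; rewrite exprMn.
Qed.

Lemma sum_sq_on_sphereD p q :
  sum_sq_on_sphere p -> sum_sq_on_sphere q -> sum_sq_on_sphere (p + q).
Proof.
move=> [ps hp] [qs hq]; exists (ps ++ qs) => x sx.
by rewrite pevalD hp // hq // -pevalD big_cat.
Qed.

Lemma sum_sq_on_sphere_sq p : sum_sq_on_sphere (p ^+ 2).
Proof. by exists [:: p] => x _; rewrite big_seq1. Qed.

Lemma sum_sq_on_sphereC c : 0 <= c -> sum_sq_on_sphere (cst c).
Proof.
move=> c0; rewrite -(sqr_sqrtr c0) (rmorphXn cst); exact: sum_sq_on_sphere_sq.
Qed.

(** On the sphere, [2 (1 - x_i)] is [(1 - x_i)^2] plus the sum of the squares of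
    the other coordinates, and likewise for [1 + x_i]. *)
Lemma sum_sq_on_sphereX i :
  pm_bound sum_sq_on_sphere 1 (X_ i).
Proof.
pose D : P := \sum_(j < n.+1 | j != i) X_ j ^+ 2.
have tD : sum_sq_on_sphere D.
  apply: (big_ind sum_sq_on_sphere) => [||j _]; last exact: sum_sq_on_sphere_sq.
    by rewrite -(mpolyC0 n.+1 R); exact: sum_sq_on_sphereC.
  exact: sum_sq_on_sphereD.
have hD x : sphere x -> peval D x = 1 - x ord0 i ^+ 2.
  move=> <-; rewrite peval_nsq (bigD1 i) //= addrAC subrr add0r peval_sum.
  by apply: eq_bigr => j _; rewrite pevalXn pevalX.
have h0 : (0 : R) <= 1/2 by lra.
have half e : sum_sq_on_sphere (cst (1/2) * ((1 + cst e * X_ i) ^+ 2 + D)).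
  apply: sum_sq_on_sphereM; first exact: sum_sq_on_sphereC.
  by apply: sum_sq_on_sphereD => //; exact: sum_sq_on_sphere_sq.
split.
- have [qs hqs] := half (-1).
  exists qs => x sx; rewrite -hqs // !(pevalD, pevalN, pevalM, pevalXn, pevalC, pevalX, peval1) hD //.
  by field.
- have [qs hqs] := half 1.
  exists qs => x sx; rewrite -hqs // !(pevalD, pevalN, pevalM, pevalXn, pevalC, pevalX, peval1) hD //.
  by field.
Qed.

(** Adding a large multiple of [(|x|^2 - 1)^2] to [p] makes it positive on the
    whole cube without changing it on the sphere, so [pos_on_cube] writes [p] as a
    sum of squares on the sphere.  As [p] is even, it equals the even part of
    that sum, and two forms of the same degree that agree on the sphere are
    equal. *)
Theorem form_pos_on_sphere_sos l p : homogeneous (2 * l) p ->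
  (forall x, sphere x -> 0 < peval p x) -> exists N, sos (nsq ^+ N * p).
Proof.
move=> hp ppos.
have [||C [e [C0 e0 ple]]] := @compact_penalty _ _ (@cube R n) (peval p)
   (fun x => peval ((nsq - 1) ^+ 2) x) (@compact_cube R n)
   (@continuous_peval _ _ _) (@continuous_peval _ _ _).
- by move=> x _; rewrite pevalXn sqr_ge0.
- move=> x _ px; rewrite pevalXn lt_def sqr_ge0 andbT sqrf_eq0 pevalB peval1 subr_eq0.
  by apply: contraL px => /eqP /ppos; rewrite -ltNge.
have [qs hqs] : sum_sq_on_sphere (p + cst C * (nsq - 1) ^+ 2).
  apply: pos_on_cube.
  - exact: sum_sq_on_sphereD.
  - exact: sum_sq_on_sphereM.
  - exact: sum_sq_on_sphereC.
  - exact: sum_sq_on_sphere_sq.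
  - exact: sum_sq_on_sphereX.
  - by move=> x cx; rewrite pevalD pevalM pevalC; apply: lt_le_trans (ple x cx).
have [a [b [A [U [sA [hA hO AO]]]]]] := sum_sq_split qs.
have pA x : sphere x -> peval p x = peval A x.
  have E y : sphere y -> peval p y = peval A y + peval U y.
    move=> sy; rewrite -AO // -hqs // pevalD pevalM pevalXn pevalB peval1 sy subrr.
    by rewrite expr0n mulr0 addr0.
  move=> sx; have := E x sx; have := E (- x) (sphereN sx).
  rewrite -scaleN1r !(pevalZ_homog _ _ hp, pevalZ_homog _ _ hA, pevalZ_homog _ _ hO).
  rewrite exprS !exprM sqrrN !expr1n; lra.
exists a; have -> : nsq ^+ a * p = nsq ^+ l * A.
  apply: (@homog_eq_on_sphere _ _ (2 * a + 2 * l)%N).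
  - exact: (homogM (homog_nsqXn _) hp).
  - by apply: (homogM (homog_nsqXn _) hA); rewrite addnC.
  - by move=> x sx; rewrite !pevalM !peval_nsqXn // pA.
by apply: sosM => //; apply: sosXn; exact: sos_nsq.
Qed.

End PositiveForms.

(** * A strict Positivstellensatz with powers of the norm as denominators *)

Section StrictPositivstellensatz.
Variables (R : realType) (n : nat).
Local Notation P := (polyX0 R n).
Local Notation cst := (@mpolyC n.+1 R).
Local Notation nsq := (nsq R n).
Local Notation sphere := (sphere (R := R) (n := n)).
Implicit Types (p q s f : P) (x : 'rV[R]_n.+1).

(** The amount by which [x] fails the constraints [G_i >= 0]. *)
Definition violation (I : finType) (G : I -> P) x : R :=
  \sum_(i : I) Num.max (- peval (G i) x) 0.

Lemma violation_ge0 (I : finType) (G : I -> P) x : 0 <= violation G x.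
Proof. by apply: sumr_ge0 => i _; rewrite le_max lexx orbT. Qed.

Lemma continuous_violation (I : finType) (G : I -> P) : continuous (violation G).
Proof.
rewrite /violation; elim: (index_enum I) => [|i r IH] x.
  rewrite (_ : (fun _ => _) = fun=> 0); first exact: (@cst_continuous _ _ (0 : R) x).
  by apply/funext => y; rewrite big_nil.
rewrite (_ : (fun _ => _) = (fun y => Num.max (peval (- G i) y) 0)
    \+ (fun y => \sum_(j <- r) Num.max (- peval (G j) y) 0)).
  apply: (@continuousD _ _ _ _ _ x _ (IH x)); apply: continuous_max.
    exact: continuous_peval.
  exact: cst_continuous.
by apply/funext => y; rewrite big_cons /= pevalN.
Qed.

Lemma positive_up_to_violation (I : finType) (G : I -> P) f :
  (forall x, sphere x -> (forall i, 0 <= peval (G i) x) -> 0 < peval f x) ->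
  exists C e : R, [/\ 0 < C, 0 < e & forall x, sphere x -> e <= peval f x + C * violation G x].
Proof.
move=> fpos; apply: compact_penalty; [exact: compact_sphere|exact: continuous_peval
  |exact: continuous_violation|by move=> x _; exact: violation_ge0|].
move=> x sx; apply: contraTT; rewrite -leNgt -ltNge => v0.
apply: fpos => // i.
have : violation G x == 0 by rewrite eq_le v0 violation_ge0.
rewrite psumr_eq0 => [/allP/(_ i)|j _]; last by rewrite le_max lexx orbT.
by rewrite mem_index_enum => /(_ isT) /= /eqP h; rewrite -oppr_le0 -h le_max lexx.
Qed.

(** [1 + m y <= (1 + y)^m] by Bernoulli, and [(1 + y)^m (1 - y)^m <= 1].  This is
    the explicit form in which the decay of [(1 - y)^m] is used. *)
Lemma geometric_le (y : R) m : 0 <= y -> y <= 1 -> (1 + m%:R * y) * (1 - y) ^+ m <= 1.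
Proof.
move=> y0 y1; elim: m => [|m IH]; first by rewrite mul0r addr0 expr0 mulr1.
have y2 : 0 <= 1 - y by rewrite subr_ge0.
apply: le_trans IH; rewrite exprSr mulrA mulrAC ler_wpM2r ?exprn_ge0 //.
have m0 : 0 <= m%:R :> R by [].
by rewrite -natr1; nra.
Qed.

(** The univariate function [y (1 - y)^m] is small for [0 <= y <= 1] and at most
    [y] for [y <= 0].  For even [m] it turns a generator into an element of the
    quadratic module that is nearly harmless where the constraint holds and a
    penalty where it fails. *)
Lemma peak_le (y : R) m : y <= 1 -> (0 < m)%N ->
  y * (1 - y) ^+ m <= m%:R^-1 - Num.max (- y) 0.
Proof.
move=> y1 m0; have m0' : 0 < m%:R :> R by rewrite ltr0n.
have [y0|y0] := leP 0 y.
  have -> : Num.max (- y) 0 = 0 by apply/max_idPr; rewrite oppr_le0.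
  rewrite subr0 -[leRHS]mul1r ler_pdivlMr //.
  have E := geometric_le m y0 y1.
  have : 0 <= (1 - y) ^+ m by rewrite exprn_ge0 // subr_ge0.
  by move: ((1 - y) ^+ m) E => t; nra.
have -> : Num.max (- y) 0 = - y by apply/max_idPl; rewrite oppr_ge0 ltW.
rewrite opprK.
have e1 : 1 <= (1 - y) ^+ m by rewrite exprn_ege1 // lerDl oppr_ge0 ltW.
have : 0 < m%:R^-1 :> R by rewrite invr_gt0.
by move: ((1 - y) ^+ m) (m%:R^-1) e1 => t u; nra.
Qed.

Lemma bounded_on_sphere p : exists2 b : R, 0 < b & forall x, sphere x -> `|peval p x| <= b.
Proof.
have [a ha] := compact_lower_bound (@compact_sphere R n) (@continuous_peval _ _ p).
have [b hb] := compact_lower_bound (@compact_sphere R n) (@continuous_peval _ _ (- p)).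
exists (`|a| + `|b| + 1); first by rewrite ltr_wpDl // addr_ge0.
move=> x sx; have := ha x sx; have := hb x sx; rewrite pevalN ler_norml.
have := ler_norm (- a); have := ler_norm (- b); rewrite !normrN.
have := normr_ge0 a; have := normr_ge0 b.
by move=> *; apply/andP; split; lra.
Qed.

(** After scaling the generators to [Y_i <= 1] on the sphere, [f] minus a multiple
    of the sum of the [Y_i (1 - Y_i)^m] is positive on the sphere for large even
    [m], by [peak_le] and [positive_up_to_violation]; homogenized with powers of
    [|x|^2], it is a form to which [form_pos_on_sphere_sos] applies. *)
Theorem strict_positivstellensatz (I : finType) (G : I -> P) (e : I -> nat) (i0 : I) l f :
  (forall i, homogeneous (2 * e i) (G i)) -> G i0 = 1 -> homogeneous (2 * l) f ->
  (forall x, sphere x -> (forall i, 0 <= peval (G i) x) -> 0 < peval f x) ->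
  exists N, hqm G (nsq ^+ N * f).
Proof.
move=> hG Gi0 hf fpos.
have /choice[b hb] i : exists b : R, 0 < b /\ forall x, sphere x -> `|peval (G i) x| <= b.
  by have [b b0 bG] := bounded_on_sphere (G i); exists b.
pose Y i := cst (b i)^-1 * G i.
have hY i : homogeneous (2 * e i) (Y i) by exact: homogCM.
have Yle1 i x : sphere x -> peval (Y i) x <= 1.
  move=> sx; have [b0 bG] := hb i.
  rewrite pevalM pevalC mulrC ler_pdivrMr // mul1r.
  by apply: le_trans (bG x sx); exact: ler_norm.
have [x sx hx|C [d [C0 d0 fge]]] := @positive_up_to_violation I Y f.
  apply: fpos => // i; have := hx i; have [b0 _] := hb i.
  by rewrite pevalM pevalC pmulr_rge0 // invr_gt0.
have [k kC] : exists k : nat, C * #|I|%:R < d * k.+1%:R.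
  exists (Num.truncn (C * #|I|%:R / d)); rewrite mulrC [d * _]mulrC -ltr_pdivrMr //.
  by rewrite [#|I|%:R * C]mulrC truncnS_gt.
pose m := (2 * k.+1)%N.
(* Half of the common degree, which has to be at least [l] and every [e i * m.+1]. *)
pose M := (l + \sum_i e i * m.+1)%N.
have eM i : (e i * m.+1 <= M)%N.
  by rewrite /M (bigD1 i) //= addnCA leq_addr.
have lM : (l <= M)%N by exact: leq_addr.
pose q i := nsq ^+ (M - e i * m.+1) * (((nsq ^+ e i - Y i) ^+ k.+1) ^+ 2 * Y i).
have hdiff i : homogeneous (2 * e i) (nsq ^+ e i - Y i).
  by apply: homogB; [exact: homog_nsqXn|].
have hqi i : homogeneous (2 * M) (q i).
  apply: (homogM (homog_nsqXn _ _ _)).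
    by apply: (homogM _ (hY i) erefl); rewrite -exprM; apply: (homogXn (hdiff i)).
  have := eM i; rewrite /m; lia.
have qE i x : sphere x -> peval (q i) x = peval (Y i) x * (1 - peval (Y i) x) ^+ m.
  move=> sx; rewrite /q pevalM peval_nsqXn // mul1r pevalM mulrC; congr (_ * _).
  by rewrite -exprM pevalXn pevalB peval_nsqXn // /m mulnC.
have hqm_q i : hqm G (q i).
  have [b0 _] := hb i.
  apply: hqm_sosM; first exact/sosXn/sos_nsq.
  apply: (@hqm_sqM _ _ _ _ _ _ _ (homogXn (hdiff i) erefl)).
  by apply: hqmC; [rewrite invr_ge0 ltW | exact: hqm_gen].
pose p := nsq ^+ (M - l) * f - cst C * \sum_i q i.
have hp : homogeneous (2 * M) p.
  apply: homogB; first by apply: (homogM (homog_nsqXn _ _ _) hf); lia.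
  by apply: homogCM; apply: homog_sum => i _; exact: hqi.
have [|N sN] := form_pos_on_sphere_sos hp.
  move=> x sx; rewrite /p pevalB !pevalM peval_nsqXn // mul1r pevalC peval_sum.
  have : \sum_i peval (q i) x <= #|I|%:R * m%:R^-1 - violation Y x.
    have -> : #|I|%:R * m%:R^-1 - violation Y x
       = \sum_(i : I) (m%:R^-1 - Num.max (- peval (Y i) x) 0).
      by rewrite sumrB sumr_const -[_ *+ #|_|]mulr_natl.
    by apply: ler_sum => i _; rewrite qE // peak_le // Yle1.
  have := fge x sx.
  have : C * (#|I|%:R * m%:R^-1) < d.
    rewrite mulrA ltr_pdivrMr ?ltr0n // /m natrM (lt_trans kC) //.
    rewrite ltr_pM2l // ltr_pMl ?ltr0n //; lra.
  move: (\sum_i _) (violation Y x) (#|I|%:R * _) => S v w h1 h2 h3.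
  have : C * S <= C * (w - v) by rewrite ler_pM2l.
  by rewrite mulrBr; lra.
exists (N + (M - l))%N.
have -> : nsq ^+ (N + (M - l)) * f = nsq ^+ N * p + nsq ^+ N * (cst C * \sum_i q i).
  by rewrite /p exprD; ring.
apply: hqmD; first exact: (hqm_sos Gi0).
apply: hqm_sosM; first exact/sosXn/sos_nsq.
apply: hqmC; first exact: ltW.
by apply: hqm_sum => i _.
Qed.

End StrictPositivstellensatz.

(** * Homogeneous components of quadratic modules *)

Section GradedExtraction.
Variables (R : realType) (n s : nat).
Local Notation P := (polyX0 R n).
Variables (S : 'I_s -> P) (e : 'I_s.+1 -> nat).
Hypothesis hG : forall i, homogeneous (2 * e i) (gfam S i).
Implicit Types (p q : P).

Definition sos_deg k p := exists qs : seq P,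
  (forall q, q \in qs -> homogeneous k q) /\ p = \sum_(q <- qs) q ^+ 2.

Lemma homog_sos_deg k p : sos_deg k p -> homogeneous (2 * k) p.
Proof.
move=> [qs [hqs ->]]; rewrite big_seq; apply: homog_sum => q qqs.
by apply: (homogXn (hqs q qqs)); rewrite mulnC.
Qed.

(** Each term [q^2 * G_i] is homogeneous of even degree, so the component of
    degree [2 E] of an element of the quadratic module is obtained by keeping the
    terms of that degree.  In it, the multipliers of [G_i] all are squares of
    forms of degree [E - e i]. *)
Lemma hqm_component E p : hqm (gfam S) p -> exists sigma : 'I_s.+1 -> P,
  (forall i, if (e i <= E)%N then sos_deg (E - e i) (sigma i) else sigma i = 0) /\
  pihomog mdeg (2 * E) p = \sum_i sigma i * gfam S i.
Proof.
elim=> [|i k q r hq _ [sigma [hs ps]]].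
  exists (fun=> 0); split=> [i|].
    by case: ifP => // _; exists [::]; rewrite big_nil.
  by rewrite pihomog0 big1 // => i _; rewrite mul0r.
have hqG : homogeneous (2 * (k + e i)) (q ^+ 2 * gfam S i).
  by apply: (homogM (homogXn hq erefl) (hG i)); lia.
rewrite pihomogD.
have [kE|kE] := eqVneq (k + e i)%N E; last first.
  exists sigma; rewrite (pihomog_ne0 (d := 2 * (k + e i))) ?add0r //.
  by rewrite eqn_pmul2l.
exists (fun j => sigma j + if j == i then q ^+ 2 else 0); split=> [j|].
  have := hs j; have [->|_] := eqVneq j i; last by rewrite addr0.
  have eE : (e i <= E)%N by rewrite -kE leq_addl.
  rewrite eE => -[qs [hqs ->]]; exists (q :: qs).
  split; last by rewrite big_cons addrC.
  move=> t; rewrite inE => /orP[/eqP ->|]; last exact: hqs.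
  by rewrite -kE addnK.
rewrite kE in hqG; rewrite ps (pihomog_dE hqG).
under [RHS]eq_bigr do rewrite mulrDl.
rewrite big_split /= addrC; congr (_ + _).
rewrite (bigD1 i) //= eqxx big1 ?addr0 // => j /negbTE ->.
by rewrite mul0r.
Qed.

Lemma MSh_of_hqm E p : homogeneous (2 * E) p -> hqm (gfam S) p -> MSh S p.
Proof.
move=> hp /(hqm_component E)[sigma [hs]]; rewrite (pihomog_dE hp) => ps.
exists (2 * E)%N, sigma; split=> // i; have := hs i; case: ifP => [eE|_].
- by move=> [qs hqs]; exists (E - e i)%N, qs.
- by move=> ->; exists 0%N, [::]; rewrite big_nil.
- by move=> /homog_sos_deg h; apply: (homogM h (hG i)); lia.
- by move=> ->; rewrite mul0r; exact: homog0.
Qed.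

(** The common degree [D] is even unless all terms vanish, since a nonzero term has
    even degree; a zero sum is homogeneous of degree [0]. *)
Lemma hqm_of_MSh p : MSh S p -> hqm (gfam S) p /\ exists E, homogeneous (2 * E) p.
Proof.
move=> [D [sigma [hs hD ->]]]; split.
  apply: hqm_sum => i _; have [k [qs [hqs ->]]] := hs i.
  rewrite big_distrl big_seq /=; apply: hqm_sum => q qqs.
  exact: (hqm_term _ _ (hqs q qqs)).
have [[i iN0]|all0] := pselect (exists i, sigma i * gfam S i != 0).
  have [k [qs hqs]] := hs i.
  have hki := homogM (homog_sos_deg (ex_intro _ qs hqs)) (hG i) erefl.
  have E := dhomog_uniq iN0 (hD i) hki.
  exists (k + e i)%N; apply: homog_sum => j _.
  by rewrite mulnDr -E; exact: hD.
exists 0%N; rewrite big1 => [|i _]; first exact: homog0.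
by apply/eqP/negPn/negP => iN0; apply: all0; exists i.
Qed.

End GradedExtraction.

(** * Forms dominated by powers of the norm *)

Section BoundedForms.
Variables (R : realType) (n : nat).
Local Notation P := (polyX0 R n).
Local Notation cst := (@mpolyC n.+1 R).
Local Notation X_ i := (@mpolyX n.+1 R (@mnm1 n.+1 i)).
Local Notation nsq := (nsq R n).
Implicit Types (p q s f : P).

(** [2 |x|^2 - 2 x_i x_j] is the sum of [(x_i - x_j)^2], of [|x|^2 - x_i^2] and of
    [|x|^2 - x_j^2]; this form of the identity also covers [i = j]. *)
Lemma pm_bound_nsq_XX i j : pm_bound (@sos R n) nsq (X_ i * X_ j).
Proof.
have nsqE k : nsq = X_ k ^+ 2 + \sum_(l < n.+1 | l != k) X_ l ^+ 2.
  by rewrite [LHS](bigD1 k).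
pose D k : P := \sum_(l < n.+1 | l != k) X_ l ^+ 2.
have sD k : sos (D k).
  by apply: hqm_sum => l _; apply: sos_sq; exact: homogX.
have hh := half_double R n.
have h0 : (0 : R) <= 1/2 by lra.
have E : 2 * nsq = D i + D j + (X_ i ^+ 2 + X_ j ^+ 2).
  by rewrite mulr2n mulrDl mul1r {1}(nsqE i) (nsqE j) /D; ring.
split.
- have -> : nsq - X_ i * X_ j = cst (1/2) * (D i + D j + (X_ i - X_ j) ^+ 2).
    transitivity (cst (1/2) * 2 * nsq - cst (1/2) * 2 * (X_ i * X_ j)).
      by rewrite hh !mul1r.
    by rewrite -mulrA E; ring.
  apply: hqmC => //; apply: sosD; first exact: sosD.
  by apply: sos_sq; apply: homogB; exact: homogX.
- have -> : nsq + X_ i * X_ j = cst (1/2) * (D i + D j + (X_ i + X_ j) ^+ 2).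
    transitivity (cst (1/2) * 2 * nsq + cst (1/2) * 2 * (X_ i * X_ j)).
      by rewrite hh !mul1r.
    by rewrite -mulrA E; ring.
  apply: hqmC => //; apply: sosD; first exact: sosD.
  by apply: sos_sq; apply: homogD; exact: homogX.
Qed.

Lemma mnm_split (m : multinom n.+1) k : mdeg m = k.+1 ->
  exists i m', mdeg m' = k /\ mpolyX R m = X_ i * mpolyX R m'.
Proof.
move=> mk.
have [i mi] : exists i, m i != 0%N.
  apply/existsP; rewrite -negb_forall; apply/negP => /forallP h.
  have : mdeg m == 0%N by rewrite mdegE sum_nat_eq0; apply/forallP => i; exact: h.
  by rewrite mk.
have le := lep1mP i m; rewrite mi in le.
exists i, (mnm_sub m (mnm1 i)).
have E := submK le.
split; last by rewrite -mpolyXD addmC E.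
have := congr1 mdeg E; rewrite mdegD mdeg1 mk addn1 => -[]; done.
Qed.

Lemma pm_bound_monomial l (m : multinom n.+1) : mdeg m = (2 * l)%N ->
  pm_bound (@sos R n) (nsq ^+ l) (mpolyX R m).
Proof.
elim: l m => [|l IH] m.
  move/eqP; rewrite muln0 mdeg_eq0 => /eqP ->; rewrite mpolyX0 expr0.
  split; first by rewrite subrr; exact: hqm0.
  by apply: sosD; exact: sos1.
rewrite mulnS => /mnm_split[i [m' [/mnm_split[j [m'' [dm ->]] ->]]]].
rewrite mulrA exprS; apply: pm_boundM.
- exact: sosD.
- exact: sosM.
- exact: sosC.
- exact: pm_bound_nsq_XX.
- exact: IH.
Qed.

(** It suffices to bound monomials, which are products of [l] factors [x_i x_j],
    each bounded by [|x|^2].  No denominator is needed here. *)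
Lemma form_bounded_by_nsq l p : homogeneous (2 * l) p ->
  exists2 c : R, 0 <= c & pm_bound (@sos R n) (cst c * nsq ^+ l) p.
Proof.
move=> /dhomogP hp.
pose Q p := exists2 c : R, 0 <= c & pm_bound (@sos R n) (cst c * nsq ^+ l) p.
rewrite -/(Q p) (mpolyE p) big_seq.
apply: (big_ind Q) => [|a b [c c0 ca] [d d0 db]|m mp].
- exists 0 => //; rewrite mpolyC0 mul0r; split; rewrite ?subr0 ?addr0; exact: hqm0.
- exists (c + d); first exact: addr_ge0.
  by rewrite rmorphD mulrDl; apply: pm_boundD => //; exact: sosD.
- exists `|mcoeff m p|; first exact: normr_ge0.
  rewrite -mul_mpolyC; apply: pm_boundM.
  + exact: sosD.
  + exact: sosM.
  + exact: sosC.
  + by apply: pm_boundC => //; exact: sosC.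
  + by apply: pm_bound_monomial; exact: hp.
Qed.

End BoundedForms.

(** * Exchanging denominators *)

Section ClearingDenominators.
Variables (R : realType) (n : nat).
Local Notation P := (polyX0 R n).
Local Notation cst := (@mpolyC n.+1 R).
Implicit Types (p q f : P).

Variable T : P -> Prop.
Hypothesis TD : forall p q, T p -> T q -> T (p + q).
Hypothesis TM : forall p q, T p -> T q -> T (p * q).
Hypothesis TC : forall c, 0 <= c -> T (cst c).

Lemma preordering_exp p k : T p -> T (p ^+ k).
Proof.
move=> Tp; elim: k => [|k IH]; first by rewrite expr0 -(mpolyC1 n.+1 R); exact/TC/ler01.
by rewrite exprS; exact: TM.
Qed.

Lemma preordering_subX p q k : T p -> T q -> T (p - q) -> T (p ^+ k - q ^+ k).
Proof.
move=> Tp Tq Tpq; rewrite subrXX; apply: (TM) => //.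
apply: T_sum => // i _; apply: (TM); exact: preordering_exp.
Qed.

Variable M : P -> Prop.
Hypothesis MD : forall p q, M p -> M q -> M (p + q).
Hypothesis TsubM : forall p, T p -> M p.
Hypothesis M_sq : forall k q p, homogeneous k q -> M p -> M (q ^+ 2 * p).

(** With [y = 1 / c], the hypotheses on [L] and [N] say that the quotient
    [rho = N / L] satisfies [y <= rho <= 1] modulo [T].  For large [l] the
    polynomial [1 - (1 - rho)^l] is close to [1] on this interval and divisible
    by [rho]; its power of exponent [2 (r + 1)] is [rho^(2 (r + 1))] times a
    square, hence its product with [f / L^k] is in [M] up to a power of [L].
    What is missing to [f / L^k] is multiplied by a factor [eta] at most
    [2 (r + 1) (1 - y)^l], so that, [f / L^k] being bounded below by [- C], it is
    compensated by [e].  The variables [X], [Y], [Z] below are [1],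
    [(1 - rho)^l] and [1 - (1 - rho)^l] multiplied by [L^l]. *)
Lemma denominator_exchange h (L N : P) (c C e : R) f k r :
  homogeneous h L -> homogeneous h N -> T L -> T N -> T (L - N) ->
  1 <= c -> T (cst c * N - L) -> 0 <= C -> T (cst C * L ^+ k + f) -> 0 < e ->
  M (N ^+ (2 * r.+1) * f) -> exists a, M (L ^+ a * (f + cst e * L ^+ k)).
Proof.
move=> hL hN TL TN TLN c1 TcN C0 TCf e0 MNf.
pose m := (2 * r).+1.
have mE : (2 * r.+1)%N = m.+1 by rewrite mulnS.
have c0 : 0 < c by apply: lt_le_trans c1.
pose y := c^-1.
have y0 : 0 < y by rewrite invr_gt0.
have y1 : y <= 1 by rewrite invf_le1.
have Ty : T (cst (1 - y) * L - (L - N)).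
  have -> : cst (1 - y) * L - (L - N) = cst y * (cst c * N - L).
    have E : cst y * cst c = 1 by rewrite -rmorphM mulVf ?rmorph1 // gt_eqF.
    transitivity (cst y * cst c * N - cst y * L); last by ring.
    by rewrite E; ring.
  by apply: (TM) => //; apply: TC; exact: ltW.
have [l lC] : exists l : nat, C * m.+1%:R <= e * (l%:R * y).
  exists (Num.truncn (C * m.+1%:R / (e * y))).+1; apply: ltW.
  by rewrite mulrCA -ltr_pdivrMr ?mulr_gt0 // truncnS_gt.
pose X := L ^+ l; pose Y := (L - N) ^+ l; pose Z := X - Y.
pose s := \sum_(i < l) L ^+ (l.-1 - i) * (L - N) ^+ i.
have ZE : Z = N * s.
  by rewrite /Z /X /Y subrXX opprB addrCA subrr addr0.
have hs : homogeneous (h * l.-1) s.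
  apply: homog_sum => i _.
  apply: (homogM (homogXn hL erefl) (homogXn (homogB hL hN) erefl)).
  rewrite -mulnDr subnK //; have := ltn_ord i; lia.
have Ts : T s by apply: T_sum => // i _; apply: (TM); exact: preordering_exp.
have TX : T X by exact: preordering_exp.
have TY : T Y by exact: preordering_exp.
have TZ : T Z by rewrite ZE; exact: TM.
have XZ : X - Z = Y by rewrite /Z opprB addrC subrK.
pose eta := X ^+ m.+1 - Z ^+ m.+1.
have Teta : T eta by apply: preordering_subX => //; rewrite XZ.
have small : T (cst m.+1%:R * (X ^+ m * Y) - eta).
  have -> : cst m.+1%:R * (X ^+ m * Y) - eta
     = Y * \sum_(i < m.+1) X ^+ (m - i) * (X ^+ i - Z ^+ i).
    rewrite /eta subrXX XZ rmorph_nat [_ * (X ^+ m * Y)]mulrA [_ * Y]mulrC -mulrBr.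
    congr (_ * _); under [RHS]eq_bigr do rewrite mulrBr.
    rewrite sumrB; congr (_ - _).
    rewrite (eq_bigr (fun=> X ^+ m)); first by rewrite sumr_const card_ord mulr_natl.
    by move=> i _; rewrite -exprD subnK // -ltnS ltn_ord.
  apply: (TM) => //; apply: T_sum => // i _; apply: (TM); first exact: preordering_exp.
  by apply: preordering_subX => //; rewrite XZ.
have TqX : T (cst ((1 - y) ^+ l) * X - Y).
  rewrite (rmorphXn cst) -exprMn; apply: preordering_subX => //.
  by apply: (TM) => //; apply: TC; rewrite subr_ge0.
have Tlast : T (cst e * X ^+ m.+1 - cst C * eta).
  have -> : cst e * X ^+ m.+1 - cst C * eta
    = X ^+ m * (cst (e - C * m.+1%:R * (1 - y) ^+ l) * X
         + cst (C * m.+1%:R) * (cst ((1 - y) ^+ l) * X - Y))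
      + cst C * (cst m.+1%:R * (X ^+ m * Y) - eta).
    rewrite exprS rmorphB !rmorphM; ring.
  apply: (TD); last by apply: (TM) => //; exact: TC.
  apply: (TM); first exact: preordering_exp.
  apply: (TD); apply: (TM) => //; apply: (TC); last by rewrite mulr_ge0.
  have := geometric_le l (ltW y0) y1.
  have : 0 <= (1 - y) ^+ l by rewrite exprn_ge0 // subr_ge0.
  have : 0 <= l%:R * y by rewrite mulr_ge0 // ltW.
  move: ((1 - y) ^+ l) (l%:R * y) (C * _) lC => q t w wt t0 q0 qt.
  have : w * q <= e * t * q by rewrite ler_wpM2r.
  have : e * (q + t * q) <= e by rewrite -[leRHS]mulr1 ler_pM2l // -[X in X + _]mul1r -mulrDl.
  have : 0 <= e * q by rewrite mulr_ge0 // ltW.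
  by rewrite mulrDr mulrA; lra.
exists (l * m.+1)%N.
have -> : L ^+ (l * m.+1) * (f + cst e * L ^+ k)
   = (s ^+ r.+1) ^+ 2 * (N ^+ (2 * r.+1) * f)
     + (eta * (cst C * L ^+ k + f) + L ^+ k * (cst e * X ^+ m.+1 - cst C * eta)).
  have -> : (s ^+ r.+1) ^+ 2 * (N ^+ (2 * r.+1) * f) = Z ^+ m.+1 * f.
    by rewrite mulrA -exprM mulnC -exprMn [s * N]mulrC -ZE mE.
  rewrite exprM -/X /eta.
  by move: (X ^+ m.+1) (Z ^+ m.+1) (L ^+ k) (cst C) (cst e) => ? ? ? ? ?; ring.
apply: MD; first by apply: (M_sq (homogXn hs erefl)).
apply: TsubM; apply: (TD); apply: (TM) => //; exact: preordering_exp.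
Qed.

End ClearingDenominators.

(** * Powers of g as denominators *)

Section Localization.
Variables (R : realType) (n : nat).
Local Notation P := (polyX0 R n).
Local Notation cst := (@mpolyC n.+1 R).
Local Notation nsq := (nsq R n).
Local Notation sphere := (sphere (R := R) (n := n)).
Implicit Types (p q f g h : P).

(** For a form [h], this family generates a quadratic module that is closed under
    products, because [h^2] is a square. *)
Definition one_and h (b : bool) : P := if b then 1 else h.

Lemma sos_one_and h p : sos p -> hqm (one_and h) p.
Proof. exact: (@hqm_sos _ _ _ _ true). Qed.

Lemma one_andM h l p q : homogeneous l h ->
  hqm (one_and h) p -> hqm (one_and h) q -> hqm (one_and h) (p * q).
Proof.
move=> hh; have th : hqm (one_and h) h by exact: (@hqm_gen _ _ _ _ false).
apply: hqmM => -[] [] /=; rewrite ?mul1r ?mulr1 //; apply: sos_one_and.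
  exact: sos1.
by rewrite -expr2; exact: (sos_sq hh).
Qed.

(** On the sphere, [g] and the negative part of [h] do not vanish together, so that
    [c g^2 > 1] wherever [h >= 0], for some [c].  Hence some power of [|x|^2]
    multiplies [c g^2 - |x|^(2 d)] into the module; raising both terms to the
    power [m] provides [P] and [Q] with [Q (P - Q)] in the module, and
    [P^2 - Q^2 = 2 Q (P - Q) + (P - Q)^2]. *)
Lemma norm_below_power E d h g : homogeneous (2 * E) h -> (0 < d)%N -> homogeneous d g ->
  (forall x, sphere x -> peval g x <= 0 -> peval h x < 0) ->
  exists (c : R) m, [/\ 0 < c, (0 < m)%N &
    hqm (one_and h) (((cst c * g ^+ 2) ^+ m) ^+ 2 - ((nsq ^+ d) ^+ m) ^+ 2)].
Proof.
move=> hh d0 hg gneg.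
pose T := hqm (one_and h).
have TD p q : T p -> T q -> T (p + q) by exact: hqmD.
have TM p q : T p -> T q -> T (p * q) by exact: one_andM hh.
have TC c : 0 <= c -> T (cst c) by move=> c0; apply: sos_one_and; exact: sosC.
have [|||x sx _|c [c' [c0 c'0 hc]]] := @compact_penalty _ _ sphere (fun=> -1)
    (fun x => peval (g ^+ 2) x + violation (fun _ : unit => h) x) (@compact_sphere R n).
- by move=> x; exact: cst_continuous.
- move=> x; apply: (@continuousD _ _ _ _ _ x); first exact: continuous_peval.
  exact: continuous_violation.
- by move=> x _; rewrite addr_ge0 ?violation_ge0 // pevalXn sqr_ge0.
- have v0 := violation_ge0 (fun _ : unit => h) x.
  have g20 : 0 <= peval (g ^+ 2) x by rewrite pevalXn sqr_ge0.
  rewrite lt_def addr_ge0 // andbT paddr_eq0 //; apply/negP => /andP[].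
  rewrite pevalXn sqrf_eq0 => /eqP gx0 /eqP.
  have := gneg x sx; rewrite gx0 lexx => /(_ isT) hx.
  rewrite /violation big_const card_unit /= addr0 => /max_idPr.
  by rewrite oppr_le0 leNgt hx.
have cpos x : sphere x -> 0 <= peval h x -> 1 < c * peval g x ^+ 2.
  move=> sx hx; have := hc x sx.
  rewrite /violation big_const card_unit /= addr0 pevalXn.
  have /max_idPr -> : - peval h x <= 0 by rewrite oppr_le0.
  by rewrite addr0; lra.
have hnd : homogeneous (2 * d) (nsq ^+ d) by exact: homog_nsqXn.
have hgam : homogeneous (2 * d) (cst c * g ^+ 2).
  by apply: homogCM; apply: (homogXn hg); rewrite mulnC.
have Tgam : T (cst c * g ^+ 2).
  by apply: sos_one_and; apply: sosM; [apply: sosC; exact: ltW | exact: sos_sq hg].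
suff [m [m0 Tm]] : exists m, (0 < m)%N /\
    T (((cst c * g ^+ 2) ^+ m) ^+ 2 - ((nsq ^+ d) ^+ m) ^+ 2) by exists c, m.
move: (cst c * g ^+ 2) (pevalM (cst c) (g ^+ 2)) hgam Tgam => gam gamE hgam Tgam.
have [N1 TN1] : exists N, T (nsq ^+ N * (gam - nsq ^+ d)).
  apply: (@strict_positivstellensatz _ _ _ _ (fun b => if b then 0 else E) true d).
  - by move=> [] //=; exact: dhomog1.
  - by [].
  - exact: homogB.
  - move=> x sx /(_ false) hx; rewrite pevalB gamE pevalC peval_nsqXn // subr_gt0.
    by rewrite pevalXn; exact: cpos.
pose m := N1.+1; exists m; split=> //.
set w := nsq ^+ d in hnd TN1 *.
have Tw : T w by apply: sos_one_and; apply: sosXn; exact: sos_nsq.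
have Tgw : T (w ^+ m * (gam - w)).
  have -> : w ^+ m = nsq ^+ (d * m - N1) * nsq ^+ N1.
    by rewrite -exprD subnK ?exprM // (leq_trans (leqnSn _)) // leq_pmull.
  rewrite -mulrA; apply: (TM) TN1.
  by apply: sos_one_and; apply: sosXn; exact: sos_nsq.
have hwm : homogeneous (2 * d * m) (w ^+ m) by exact: (homogXn hnd).
have hgm : homogeneous (2 * d * m) (gam ^+ m) by exact: (homogXn hgam).
have -> : (gam ^+ m) ^+ 2 - (w ^+ m) ^+ 2
    = cst 2 * (w ^+ m * (gam ^+ m - w ^+ m)) + (gam ^+ m - w ^+ m) ^+ 2.
  by rewrite rmorph_nat; move: (gam ^+ m) (w ^+ m) => ? ?; ring.
apply: (TD); last by apply: sos_one_and; exact: (sos_sq (homogB hgm hwm)).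
apply: (TM); first exact: TC.
rewrite subrXX mulrA; apply: (TM) Tgw _.
by apply: T_sum => // i _; apply: (TM); exact: preordering_exp.
Qed.

(** Wherever all [G i] are nonnegative so is [h], hence [g > 0] there.  After
    multiplication by a power of [g], the degree of [f] is that of a power [L^k]
    of the form [L] supplied by [norm_below_power], and
    [f - ep * L^k] is still positive on [{G i >= 0}] for a small [ep].  By
    [strict_positivstellensatz] it is in the module up to a power of [|x|^2],
    which [denominator_exchange] replaces by a power of [L] at the cost of adding
    [ep * L^k] back. *)
Theorem localized_positivstellensatz (I : finType) (G : I -> P) (e : I -> nat) (i0 : I)
    E d k h g f :
  (forall i, homogeneous (2 * e i) (G i)) -> G i0 = 1 ->
  hqm G h -> homogeneous (2 * E) h -> (0 < d)%N -> homogeneous d g ->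
  (forall x, sphere x -> peval g x <= 0 -> peval h x < 0) ->
  homogeneous (k * d) f ->
  (forall x, sphere x -> (forall i, 0 <= peval (G i) x) -> 0 < peval f x) ->
  exists N, hqm G (g ^+ N * f).
Proof.
move=> hG Gi0 Mh hh d0 hg gneg hf fpos.
pose T := hqm (one_and h); pose M := hqm G.
have TsubM p : T p -> M p by apply: hqm_sub => -[] //=; exact: (hqm_sos Gi0 (sos1 _ _)).
have TD p q : T p -> T q -> T (p + q) by exact: hqmD.
have TM p q : T p -> T q -> T (p * q) by exact: one_andM hh.
have TC c : 0 <= c -> T (cst c) by move=> c0; apply: sos_one_and; exact: sosC.
have [c [m [c0 m0 TLN]]] := norm_below_power hh d0 hg gneg.
set L := (_ ^+ m) ^+ 2 in TLN; set N := (_ ^+ m) ^+ 2 in TLN.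
have LE : L = cst (c ^+ (2 * m)) * g ^+ (4 * m).
  rewrite /L -exprM exprMn -exprM (rmorphXn cst).
  by congr (_ ^+ _ * _ ^+ _); lia.
have NE : N = nsq ^+ (2 * d * m) by rewrite /N -!exprM; congr (_ ^+ _); lia.
pose D := (2 * d * m)%N.
have hgm : homogeneous D ((cst c * g ^+ 2) ^+ m).
  by apply: (homogXn (homogCM _ (homogXn hg erefl))); rewrite /D [(2 * d)%N]mulnC.
have hL : homogeneous (2 * D) L by apply: (homogXn hgm); rewrite mulnC.
have hN : homogeneous (2 * D) N by rewrite NE; exact: homog_nsqXn.
have TL : T L by apply: sos_one_and; exact: (sos_sq hgm).
have TN : T N by rewrite NE; apply: sos_one_and; apply: sosXn; exact: sos_nsq.
have [c1 c10 [Tc1 _]] := form_bounded_by_nsq hL.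
rewrite -NE in Tc1.
have Tc1N : T (cst (c1 + 1) * N - L).
  have -> : cst (c1 + 1) * N - L = (cst c1 * N - L) + N.
    by rewrite rmorphD rmorph1 mulrDl mul1r addrAC.
  exact: (TD _ _ (sos_one_and _ Tc1) TN).
(* [4 * m] is the exponent of [g] in [L]: the degree of [f1] is [k] times that of [L]. *)
pose j := (4 * m * k - k)%N.
have jk : (j + k)%N = (4 * m * k)%N by rewrite subnK // leq_pmull // muln_gt0.
pose f1 := g ^+ j * f.
have hf1 : homogeneous (2 * (D * k)) f1.
  apply: (homogM (homogXn hg erefl) hf).
  by rewrite [(k * d)%N]mulnC -mulnDr jk /D; nia.
have f1pos x : sphere x -> (forall i, 0 <= peval (G i) x) -> 0 < peval f1 x.
  move=> sx Gx; rewrite pevalM pevalXn mulr_gt0 ?fpos // exprn_gt0 //.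
  rewrite ltNge; apply/negP => /(gneg x sx); rewrite ltNge => /negP[].
  exact: (hqm_ge0 Mh Gx).
have [C1 [e1 [_ e10 he1]]] := positive_up_to_violation f1pos.
have [b b0 hb] := bounded_on_sphere (L ^+ k).
pose ep := e1 / (2 * b).
have ep0 : 0 < ep by rewrite divr_gt0 // mulr_gt0.
pose f2 := f1 - cst ep * L ^+ k.
have hLk : homogeneous (2 * (D * k)) (L ^+ k) by apply: (homogXn hL); rewrite mulnA.
have hf2 : homogeneous (2 * (D * k)) f2 by apply: homogB => //; exact: homogCM.
have [N2 MN2] : exists N, M (nsq ^+ N * f2).
  apply: (strict_positivstellensatz hG Gi0 hf2) => x sx Gx.
  have := he1 x sx; have -> : violation G x = 0.
    by apply: big1 => i _; apply/max_idPr; rewrite oppr_le0.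
  rewrite mulr0 addr0 pevalB pevalM pevalC.
  have : ep * peval (L ^+ k) x <= ep * b.
    by rewrite ler_pM2l // (le_trans _ (hb x sx)) // ler_norm.
  have -> : ep * b = e1 / 2 by rewrite /ep; field; rewrite gt_eqF.
  by lra.
have MN : M (N ^+ (2 * N2.+1) * f2).
  have D0 : (0 < D)%N by rewrite !muln_gt0 d0 m0.
  have -> : N ^+ (2 * N2.+1) * f2
     = nsq ^+ (D * (2 * N2.+1) - N2) * (nsq ^+ N2 * f2).
    rewrite NE mulrA -exprD subnK ?exprM //.
    by rewrite (leq_trans (leqnSn _)) // mulnA leq_pmull // muln_gt0 D0.
  by apply: hqm_sosM MN2; apply: sosXn; exact: sos_nsq.
have [c2 c20 [_ Tc2]] := form_bounded_by_nsq hf2.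
rewrite exprM -NE in Tc2.
have TC2 : T (cst c2 * L ^+ k + f2).
  have -> : cst c2 * L ^+ k + f2 = cst c2 * (L ^+ k - N ^+ k) + (cst c2 * N ^+ k + f2).
    by rewrite [cst c2 * (_ - _)]mulrBr -[RHS]addrA addKr.
  apply: (TD) (sos_one_and _ Tc2).
  exact: (TM _ _ (TC _ c20) (preordering_subX TD TM TC k TL TN TLN)).
have [a Ma] : exists a, M (L ^+ a * (f2 + cst ep * L ^+ k)).
  apply: (denominator_exchange TD TM TC _ TsubM _
    hL hN TL TN TLN _ Tc1N c20 TC2 ep0 MN).
  - by move=> p q; exact: hqmD.
  - by move=> l q p; exact: hqm_sqM.
  - by rewrite lerDr.
exists (4 * m * a + j)%N.
have -> : g ^+ (4 * m * a + j) * f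
    = cst ((c ^+ (2 * m * a))^-1) * (L ^+ a * (f2 + cst ep * L ^+ k)).
  rewrite /f2 subrK /f1.
  have -> : L ^+ a = cst (c ^+ (2 * m * a)) * g ^+ (4 * m * a).
    by rewrite LE exprMn -(rmorphXn cst) -!exprM.
  rewrite exprD !mulrA -(rmorphM cst) mulVf ?expf_neq0 ?gt_eqF //.
  by rewrite rmorph1 mul1r.
by apply: hqmC Ma; rewrite invr_ge0 exprn_ge0 // ltW.
Qed.

End Localization.

(** * The theorem *)

Theorem mainTheorem2 (R : realType) (n s : nat) (S : 'I_s -> polyX0 R n)
  (hS : forall i, exists k : nat, ~~ odd k /\ homogeneous k (S i))
  (K K0 : set 'rV[R]_n.+1)
  (hunion : KSh S = K `|` K0)
  (hdisj : K `&` K0 = set0)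
  (hK : closed_punctured K)
  (hK0 : closed_punctured K0)
  (hint : interior (KSh S) `<=` K)
  (d : nat) (hd : (0 < d)%N) (hdeven : ~~ odd d)
  (g : polyX0 R n)
  (hg : homogeneous d g)
  (hgK : forall x, K x -> 0 < peval g x)
  (hgK0 : forall x, K0 x -> peval g x = 0)
  (hgm : exists gm : polyX0 R n,
      [/\ MSh S gm,
          forall x : 'rV[R]_n.+1, x != 0 -> peval g x <= 0 -> peval gm x < 0
        & K `<=` [set x | 0 < peval gm x]])
  (f : polyX0 R n)
  (hf : exists k : nat, homogeneous (k * d) f)
  (hfK : forall x, K x -> 0 < peval f x) :
  exists N : nat, MSh S (g ^+ N * f).
Proof.
have [h [MSh_h gneg _]] := hgm.
have [k hfk] := hf.
have /choice[e hG] : forall i, exists e, homogeneous (2 * e) (gfam S i).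
  move=> i; rewrite /gfam; case: unliftP => [j _|_]; last by exists 0%N; exact: dhomog1.
  by have [t [te ht]] := hS j; exists t./2; rewrite mul2n even_halfK.
have G0 : gfam S ord0 = 1 by rewrite /gfam unlift_none.
have [Mh [E hh]] := hqm_of_MSh hG MSh_h.
have gneg_sphere (x : 'rV[R]_n.+1) : sphere x -> peval g x <= 0 -> peval h x < 0.
  by move=> sx; apply: gneg; exact: sphere_neq0.
(* A point of [K0] would satisfy [g = 0], hence [h < 0], although [h] is in the quadratic module. *)
have inK x : sphere x -> (forall i, 0 <= peval (gfam S i) x) -> K x.
  move=> sx Gx; have x0 := sphere_neq0 sx.
  have : KSh S x.
    by split=> // i; have := Gx (lift ord0 i); rewrite /gfam liftK.
  rewrite hunion => -[//|K0x].
  have := gneg_sphere x sx; rewrite (hgK0 x K0x) lexx => /(_ isT).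
  by rewrite ltNge (hqm_ge0 Mh Gx).
have [N MN] := localized_positivstellensatz hG G0 Mh hh hd hg gneg_sphere hfk
  (fun x sx Gx => hfK x (inK x sx Gx)).
exists N; apply: (MSh_of_hqm hG _ MN (E := (d * N + k * d)./2)).
apply: (homogM (homogXn hg erefl) hfk).
by rewrite mul2n even_halfK // oddD !oddM (negbTE hdeven) andbF.
Qed.
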